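(* The following decision problem is NP-complete, even when the input graph is restricted to be a split graph: given a graph $G$ and an integer $p\ge 2$ (both part of the input), decide whether $G$ has a $P_3$-convex $p$-cover.
   Context: Graphs are finite, undirected, without loops or multiple edges. A set $S\subseteq V(G)$ is $P_3$-convex if for every path on three vertices (not necessarily induced) of $G$ whose two end-vertices belong to $S$, the middle vertex also belongs to $S$. A $P_3$-convex $p$-cover of $G$ is a family $V_1,\ldots,V_p$ (repetitions and empty sets allowed) of $p$ $P_3$-convex sets, each different from $V(G)$, such that $V_1\cup\cdots\cup V_p=V(G)$. A split graph is a graph whose vertex set can be partitioned into a clique and a set of pairwise nonadjacent vertices. *)

(* Defs.v *)
From mathcomp Require Import all_boot.

Set Implicit Arguments.
Unset Strict Implicit.
Unset Printing Implicit Defensive.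

Inductive move := MoveLeft | Stay | MoveRight.

(* A cell of a tape over the alphabet [G] contains [None] (blank) or a symbol
   of [G].  Tapes are infinite in both directions: [tleft] lists the cells to
   the left of the head, nearest first, [tright] those to its right, and all
   the unlisted cells are blank. *)
Record tape (G : Type) := Tape {
  tleft : seq (option G);
  thead : option G;
  tright : seq (option G)
}.

Definition write (G : Type) (a : option G) (t : tape G) : tape G :=
  Tape (tleft t) a (tright t).

Definition move_head (G : Type) (m : move) (t : tape G) : tape G :=
  let: Tape l a r := t in
  match m with
  | MoveLeft => Tape (behead l) (head None l) (a :: r)
  | Stay => t
  | MoveRight => Tape (a :: l) (head None r) (behead r)
  end.

Definition tape_of_word (G : Type) (s : seq G) : tape G :=
  Tape [::] (ohead s) (map Some (behead s)).

Fixpoint until_blank (G : Type) (s : seq (option G)) : seq G :=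
  if s is Some a :: s' then a :: until_blank s' else [::].

Definition word_of_tape (G : Type) (t : tape G) : seq G :=
  until_blank (thead t :: tright t).

Record machine (G : finType) := Machine {
  state : finType;
  ntapes' : nat;
  start : state;
  halting : pred state;
  delta : state -> {ffun 'I_ntapes'.+1 -> option G} ->
          state * {ffun 'I_ntapes'.+1 -> option G * move}
}.

Section Runs.
Variables (G : finType) (M : machine G).

Notation tapes := {ffun 'I_(ntapes' M).+1 -> tape G}.

Record config := Config { cstate : state M; ctapes : tapes }.

Definition step (c : config) : config :=
  if halting (cstate c) then c else
  let: (q, act) := delta (cstate c) [ffun i => thead (ctapes c i)] in
  Config q [ffun i => move_head (act i).2 (write (act i).1 (ctapes c i))].

(* The input is on tape [ord0]; the output is read on tape [ord_max] (the same
   tape if there is only one). *)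
Definition initial (s : seq G) : config :=
  Config (start M) [ffun i => tape_of_word (if i == ord0 then s else [::])].

Definition output (c : config) : seq G := word_of_tape (ctapes c ord_max).

(* Halting configurations are fixed by [step], so the first condition says
   that the machine halts after at most [t] steps. *)
Definition computes_in (s : seq G) (t : nat) (s' : seq G) : Prop :=
  let c := iter t step (initial s) in halting (cstate c) /\ output c = s'.

End Runs.

(* Every polynomial with natural coefficients is dominated by some of these. *)
Definition poly_bound (c d n : nat) : nat := c * n ^ d + c.

Definition polytime (A B : finType) (f : seq A -> seq B) : Prop :=
  exists (G : finType) (iA : A -> G) (iB : B -> G) (M : machine G) (c d : nat),
    [/\ injective iA, injective iB &
        forall x : seq A,
          computes_in M (map iA x) (poly_bound c d (size x)) (map iB (f x))].

Definition language (A : finType) := seq A -> Prop.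

Definition polytime_pred (A : finType) (V : pred (seq A)) : Prop :=
  polytime (fun x => [:: V x]).

Definition pair_word (A B : finType) (x : seq A) (y : seq B) : seq (A + B) :=
  map inl x ++ map inr y.

Definition in_NP (A : finType) (L : language A) : Prop :=
  exists (V : pred (seq (A + bool))) (c d : nat),
    polytime_pred V /\
    forall x : seq A,
      L x <-> exists y : seq bool,
                size y <= poly_bound c d (size x) /\ V (pair_word x y).

Definition poly_reduces (A B : finType) (L : language A) (L' : language B)
    : Prop :=
  exists f : seq A -> seq B, polytime f /\ forall x, L x <-> L' (f x).

Definition NP_hard (A : finType) (L : language A) : Prop :=
  forall (B : finType) (L' : language B), in_NP L' -> poly_reduces L' L.

Definition NP_complete (A : finType) (L : language A) : Prop :=
  in_NP L /\ NP_hard L.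

Record sgraph := SGraph {
  vertex : finType;
  edge : rel vertex;
  edge_sym : symmetric edge;
  edge_irrefl : irreflexive edge
}.

(* [u - v - w] is a path on three vertices; [v] differs from [u] and [w] by
   irreflexivity. *)
Definition P3_convex (G : sgraph) (S : {set vertex G}) : Prop :=
  forall u v w : vertex G,
    edge u v -> edge v w -> u != w -> u \in S -> w \in S -> v \in S.

Definition has_P3_convex_cover (G : sgraph) (p : nat) : Prop :=
  exists V : 'I_p -> {set vertex G},
    (forall i, P3_convex (V i) /\ V i != [set: vertex G]) /\
    \bigcup_(i < p) V i = [set: vertex G].

Definition is_split (G : sgraph) : Prop :=
  exists K : {set vertex G},
    (forall u v, u \in K -> v \in K -> u != v -> edge u v) /\
    (forall u v, u \notin K -> v \notin K -> ~~ edge u v).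

(* Binary expansion, least significant bit first, without leading zeros:
   [up_log 2 n.+1] is the number of binary digits of [n]. *)
Definition binary (n : nat) : seq bool :=
  mkseq (fun i => odd (n %/ 2 ^ i)) (up_log 2 n.+1).

(* The alphabet consists of the two bits and of the end marker [None]. *)
Definition field_word (s : seq bool) : seq (option bool) :=
  rcons (map Some s) None.

(* [p] in binary, followed by the rows of the adjacency matrix of [G]. *)
Definition encode (G : sgraph) (p : nat) : seq (option bool) :=
  field_word (binary p) ++
  flatten [seq field_word [seq edge u v | v <- enum (vertex G)]
          | u <- enum (vertex G)].

Definition language_of (yes : sgraph -> nat -> Prop) : language (option bool) :=
  fun x => exists (G : sgraph) (p : nat), yes G p /\ x = encode G p.

Definition P3_convex_cover_problem : language (option bool) :=
  language_of (fun G p => 2 <= p /\ has_P3_convex_cover G p).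

Definition P3_convex_cover_problem_split : language (option bool) :=
  language_of (fun G p => [/\ is_split G, 2 <= p & has_P3_convex_cover G p]).

(* Main.v *)
(** Stack machines with finitely many stacks, whose programs compile to the
    given multi-tape machines, evaluate in polynomial time every arithmetic
    expression over unary numbers built from sums, truncated differences,
    bounded summation and lookups in the input.  Hence a word whose length and
    letters are given by such expressions is computable in polynomial time,
    and so is a predicate defined by bounded quantification.

    Membership: a cover by [p] proper convex sets can be thinned out to one by
    at most [n] sets (singletons, if [p > n]), and checking it is a bounded
    formula.

    Hardness: the tableau of a verifier is a CNF formula, which is turned into
    a graph [H] to be coloured with [B] colours, as in Karp's reduction.  Let
    [G] be the split graph whose clique [Q] is the set of pairs of vertices of
    [H], whose independent set is the set of vertices of [H], and in which
    [(a, b)] is adjacent to [a], and to [b] if [ab] is an edge of [H].  A proper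
    convex set of [G] is a singleton of the clique or an independent set of [H],
    so that [G] has a cover by [|Q| + B] such sets iff [H] is [B]-colourable. *)

Require Import Defs.
From mathcomp Require Import all_boot.
From mathcomp Require Import zify.

Set Implicit Arguments.
Unset Strict Implicit.
Unset Printing Implicit Defensive.

Local Notation thead := Defs.thead.

(** * Stack programs *)

Section Programs.
Variable G : finType.

(** Numbers are unary stack heights, so every definable value is polynomially bounded. The input
    [p], however, is binary and may be exponential in the length of the word, so the verifier never
    builds it. Repeating a set turns a cover by [m > 0] sets into one by any [p >= m] sets; hence it
    is enough to find a suitable [m] and to check that the digits of [p] spell no number below [m]
    or below 2. The clique of the split graph has all pairs, and not only the edges of [H], so that
    each vertex of [H] has at least two neighbours in it: two clique vertices then generate the
    whole graph. The [B] colours are pairwise adjacent in [H]; with the [Q = |Q|] clique vertices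
    they need [Q + B] different sets, which leaves no set over and makes every other vertex of [H]
    share the set of a colour. In the tableau the head stays at a fixed position and the tapes slide
    beneath it: no variable records head positions, and every transition clause finds the scanned
    symbols at one known place. *)

Definition store := nat -> seq G.

Definition upd (st : store) i w : store := fun j => if j == i then w else st j.

Inductive cmd :=
| Skip
| Push of nat & G
| Dup of nat & nat
| Pop of nat
| Seq of cmd & cmd
| IfTop of nat & pred (option G) & cmd & cmd
| While of nat & cmd.

(* The time is an upper bound, and stores matter up to pointwise equality. *)
Inductive exec : cmd -> store -> nat -> store -> Prop :=
| E_skip st : exec Skip st 1 st
| E_push i a st : exec (Push i a) st 2 (upd st i (a :: st i))
| E_dup i j a w st : i != j -> st i = a :: w ->
    exec (Dup i j) st 2 (upd st j (a :: st j))
| E_pop i st : exec (Pop i) st 1 (upd st i (behead (st i)))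
| E_seq c1 c2 st1 n st2 m st3 :
    exec c1 st1 n st2 -> exec c2 st2 m st3 -> exec (Seq c1 c2) st1 (n + m) st3
| E_if i b c1 c2 st n st' :
    exec (if b (ohead (st i)) then c1 else c2) st n st' ->
    exec (IfTop i b c1 c2) st n.+1 st'
| E_while0 i c st : st i = [::] -> exec (While i c) st 1 st
| E_whileS i c st n st1 m st2 : st i <> [::] ->
    exec c st n st1 -> exec (While i c) st1 m st2 ->
    exec (While i c) st (n + m).+1 st2
| E_conv c st n st' st0 m st0' :
    exec c st0 n st0' -> st =1 st0 -> n <= m -> st0' =1 st' ->
    exec c st m st'.

Fixpoint bound (c : cmd) : nat :=
  match c with
  | Skip => 0
  | Push i _ | Pop i => i.+1
  | Dup i j => maxn i.+1 j.+1
  | Seq c1 c2 => maxn (bound c1) (bound c2)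
  | IfTop i _ c1 c2 => maxn i.+1 (maxn (bound c1) (bound c2))
  | While i c => maxn i.+1 (bound c)
  end.

(** * Machines with a single exit and their composition *)

Variable k' : nat.
Notation k := k'.+1.
Notation scan := {ffun 'I_k -> option G}.
Notation action := {ffun 'I_k -> option G * move}.
Notation tapes := {ffun 'I_k -> tape G}.

(* A machine with a single exit, the target [None] of its transitions. *)
Record flow := Flow {
  fstate : finType;
  entry : fstate;
  fdelta : fstate -> scan -> option fstate * action
}.

Definition act (a : action) (t : tapes) : tapes :=
  [ffun i => move_head (a i).2 (write (a i).1 (t i))].

Definition scanned (t : tapes) : scan := [ffun i => thead (t i)].

Inductive reach (P : flow) : fstate P -> tapes -> nat -> tapes -> Prop :=
| reach1 s t a : fdelta s (scanned t) = (None, a) -> reach s t 1 (act a t)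
| reachS s t s' a n t' : fdelta s (scanned t) = (Some s', a) ->
    reach s' (act a t) n t' -> reach s t n.+1 t'.

Definition idle (sc : scan) : action := [ffun i => (sc i, Stay)].

Lemma act_idle t : act (idle (scanned t)) t = t.
Proof. by apply/ffunP => i; rewrite !ffunE /=; case: (t i). Qed.

Definition fone (f : scan -> action) : flow :=
  @Flow unit tt (fun _ sc => (None, f sc)).

Definition fseq (P Q : flow) : flow :=
  @Flow (fstate P + fstate Q)%type (inl (entry P)) (fun s sc =>
    match s with
    | inl s => let: (o, a) := fdelta s sc in
               (Some (if o is Some s' then inl s' else inr (entry Q)), a)
    | inr s => let: (o, a) := fdelta s sc in (omap inr o, a)
    end).

Definition fif (i : nat) (b : pred (option G)) (P Q : flow) : flow :=
  @Flow (option (fstate P + fstate Q)) None (fun s sc =>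
    match s with
    | None => (Some (Some (if b (sc (inord i)) then inl (entry P)
                           else inr (entry Q))), idle sc)
    | Some (inl s) => let: (o, a) := fdelta s sc in (omap (Some \o inl) o, a)
    | Some (inr s) => let: (o, a) := fdelta s sc in (omap (Some \o inr) o, a)
    end).

(* The exit [None] of the body is the state that tests the loop condition. *)
Definition fwhile (i : nat) (P : flow) : flow :=
  @Flow (option (fstate P)) None (fun s sc =>
    match s with
    | None => (if sc (inord i) then Some (Some (entry P)) else None, idle sc)
    | Some s => let: (o, a) := fdelta s sc in (Some o, a)
    end).

Definition runs (P : flow) t n t' := reach (entry P) t n t'.

Lemma runs_one f t : runs (fone f) t 1 (act (f (scanned t)) t).
Proof. exact: reach1. Qed.

Lemma runs_seq P Q t1 n t2 m t3 :
  runs P t1 n t2 -> runs Q t2 m t3 -> runs (fseq P Q) t1 (n + m) t3.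
Proof.
rewrite /runs /= => HP HQ.
have {}HQ : reach (P := fseq P Q) (inr (entry Q)) t2 m t3.
  elim: HQ => [s t a e|s t s' a l t' e _ IH].
    by apply: reach1; rewrite /= e.
  by apply: reachS IH; rewrite /= e.
elim: HP HQ => [s t a e|s t s' a l t' e _ IH] HQ.
  by rewrite add1n; apply: reachS HQ; rewrite /= e.
by rewrite addSn; apply: reachS (IH HQ); rewrite /= e.
Qed.

Lemma runs_if i b P Q (t : tapes) n t' :
  runs (if b (thead (t (inord i))) then P else Q) t n t' ->
  runs (fif i b P Q) t n.+1 t'.
Proof.
rewrite /runs => H.
apply: (@reachS (fif i b P Q) None _ (Some (if b (thead (t (inord i))) then inl (entry P)
                           else inr (entry Q))) (idle (scanned t))).
  by rewrite /= ffunE.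
rewrite act_idle; case: (b _) H => H.
  elim: H => [s u a e|s u s' a l u' e _ IH].
    by apply: reach1; rewrite /= e.
  by apply: reachS IH; rewrite /= e.
elim: H => [s u a e|s u s' a l u' e _ IH].
  by apply: reach1; rewrite /= e.
by apply: reachS IH; rewrite /= e.
Qed.

Lemma runs_while0 i P (t : tapes) :
  thead (t (inord i)) = None -> runs (fwhile i P) t 1 t.
Proof.
move=> e; rewrite -{2}[t]act_idle; apply: reach1.
by rewrite /= ffunE e.
Qed.

Lemma runs_whileS i P (t : tapes) n t1 m t2 : thead (t (inord i)) ->
  runs P t n t1 -> runs (fwhile i P) t1 m t2 ->
  runs (fwhile i P) t (n + m).+1 t2.
Proof.
rewrite /runs => e HP HW.
apply: (@reachS (fwhile i P) None _ (Some (entry P)) (idle (scanned t))).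
  by rewrite /= ffunE e.
rewrite act_idle.
elim: HP HW {e} => [s u a e|s u s' a l u' e _ IH] HW.
  by rewrite add1n; apply: reachS HW; rewrite /= e.
by rewrite addSn; apply: reachS (IH HW); rewrite /= e.
Qed.

Definition machine_of (P : flow) : machine G :=
  @Machine G (option (fstate P)) k' (Some (entry P)) (fun s => ~~ s)
    (fun s sc => if s is Some s' then fdelta s' sc else (None, idle sc)).

Lemma runs_machine P t n t' : runs P t n t' ->
  iter n (@step G (machine_of P)) (@Config G (machine_of P) (Some (entry P)) t)
  = @Config G (machine_of P) None t'.
Proof.
rewrite /runs; elim => [s u a e|s u s' a l u' e _ IH].
  by rewrite /= /step /= [fdelta _ _]e.
by rewrite iterSr -IH /step /= [fdelta _ _]e.
Qed.

Definition on (i : nat) (o : option G * move) (sc : scan) : action :=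
  [ffun j : 'I_k => if j == i :> nat then o else (sc j, Stay)].

Lemma act_on i o t j : act (on i o (scanned t)) t j =
  if j == i :> nat then move_head o.2 (write o.1 (t j)) else t j.
Proof. by rewrite !ffunE; case: eqP => //= _; case: (t j). Qed.

Definition shift (i : nat) (m : move) : flow :=
  fone (fun sc => [ffun j : 'I_k => (sc j, if j == i :> nat then m else Stay)]).

Lemma runs_shift i m (t : tapes) : exists t' : tapes,
  runs (shift i m) t 1 t' /\
  forall j : 'I_k, t' j = if j == i :> nat then move_head m (t j) else t j.
Proof.
eexists; split; first exact: runs_one.
by move=> j; rewrite !ffunE /=; case: eqP; case: (t j).
Qed.

(** * Compilation of programs: stacks on tapes *)

Fixpoint compile (c : cmd) : flow :=
  match c with
  | Skip => fone idle
  | Push i a => fseq (shift i MoveRight) (fone (on i (Some a, Stay)))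
  | Dup i j =>
      fseq (shift j MoveRight) (fone (fun sc => on j (sc (inord i), Stay) sc))
  | Pop i => fone (on i (None, MoveLeft))
  | Seq c1 c2 => fseq (compile c1) (compile c2)
  | IfTop i b c1 c2 => fif i b (compile c1) (compile c2)
  | While i c => fwhile i (compile c)
  end.

(** The head stands on the top of the stack, and the bottom is to the left. The blanks on either
    side are listed cells left behind by earlier pops and moves: tapes are lists and are not
    identified up to trailing blanks. *)
Definition is_stack (w : seq G) (t : tape G) : Prop :=
  exists m n, thead t :: tleft t = map Some w ++ nseq m None
              /\ tright t = nseq n None.

Definition stacks (st : store) (t : tapes) : Prop :=
  forall i : 'I_k, is_stack (st i) (t i).

Lemma thead_stack w t : is_stack w t -> thead t = ohead w.
Proof. by case=> [[|m] [n []]]; case: w => [|a w] //= []. Qed.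

Lemma thead_stacks st (t : tapes) i : i < k -> stacks st t ->
  thead (t (inord i)) = ohead (st i).
Proof. by move=> ik /(_ (inord i))/thead_stack->; rewrite inordK. Qed.

Lemma runs_push_top st t i : stacks st t -> exists t' : tapes,
  runs (shift i MoveRight) t 1 t' /\
  forall j : 'I_k, if j == i :> nat
    then forall a, is_stack (a :: st j) (write (Some a) (t' j))
    else t' j = t j.
Proof.
move=> H; have [t' [R e]] := runs_shift i MoveRight t.
exists t'; split=> // j; rewrite e; case: eqP => // _ a; case: (H j) => m [n []].
case: (t j) => l h r /= -> ->.
by exists m, n.-1; case: n.
Qed.

(** The input extends to the right of the head, whereas a stack ends under it: once the head has
    walked to the last letter, that letter is the top, so the stack holds the reversed word.
    [unload] walks to the bottom, from where the output is read rightwards, and reverses again. *)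
Definition load : flow :=
  fseq (fwhile 0 (shift 0 MoveRight)) (shift 0 MoveLeft).

Definition unload (i : nat) : flow :=
  fseq (fwhile i (shift i MoveLeft)) (shift i MoveRight).

Lemma runs_skip_right (w : seq G) p (t : tapes) :
  t ord0 = Tape (map Some p) (ohead w) (map Some (behead w)) ->
  exists t' : tapes,
  runs (fwhile 0 (shift 0 MoveRight)) t (2 * size w).+1 t' /\
  forall j : 'I_k, t' j =
    if j == ord0 then Tape (map Some (rev w ++ p)) None [::] else t j.
Proof.
have i0 : inord 0 = ord0 :> 'I_k by apply: val_inj; rewrite /= inordK.
elim: w p t => [|a w IH] p t e.
  exists t; split.
    by apply: runs_while0; rewrite i0 e.
  by move=> j; case: eqP => // ->.
have [t1 [R1 e1]] := runs_shift 0 MoveRight t.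
have {IH}[|t2 [R2 e2]] := IH (a :: p) t1.
  by rewrite e1 /= e; case: (w).
exists t2; split.
  have -> : (2 * size (a :: w)).+1 = (1 + (2 * size w).+1).+1.
    by rewrite /= mulnS.
  by apply: runs_whileS R1 R2; rewrite i0 e.
move=> j; rewrite e2 e1 rev_cons cat_rcons -(inj_eq val_inj).
by case: eqP.
Qed.

Lemma runs_load (w : seq G) (t : tapes) :
  (forall j, t j = tape_of_word (if j == ord0 then w else [::])) ->
  exists t', runs load t (2 * size w).+2 t' /\
             stacks (fun i => if i == 0 then rev w else [::]) t'.
Proof.
move=> e; have [|t1 [R1 e1]] := @runs_skip_right w [::] t.
  by rewrite e eqxx.
have [t2 [R2 e2]] := runs_shift 0 MoveLeft t1.
exists t2; split; first by rewrite -addn1; apply: runs_seq R1 R2.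
move=> j; rewrite e2 e1 -(inj_eq val_inj) /= cats0 e.
case: eqP => [_|/eqP/negPf ne] /=.
  case: (rev w) => [|a u] /=; first by exists 1, 1.
  by exists 0, 1; rewrite cats0.
by rewrite -(inj_eq val_inj) /= ne /=; exists 1, 0.
Qed.

Lemma runs_skip_left i (w : seq G) m (t : tapes) : i < k ->
  Defs.thead (t (inord i)) :: tleft (t (inord i)) = map Some w ++ nseq m None ->
  exists t' : tapes,
  [/\ runs (fwhile i (shift i MoveLeft)) t (2 * size w).+1 t',
      thead (t' (inord i)) = None &
      tright (t' (inord i)) = map Some (rev w) ++ tright (t (inord i))].
Proof.
move=> ik; elim: w m t => [|a w IH] m t e.
  have e0 : thead (t (inord i)) = None by case: m e => //= m [].
  by exists t; split=> //; apply: runs_while0.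
have [t1 [R1 e1]] := runs_shift i MoveLeft t.
have := e1 (inord i); rewrite inordK // eqxx => e2.
(* Below the bottom letter the head lands on a blank, which the move creates if none is listed:
   hence [m.-1.+1]. *)
have {IH}[|t2 [R2 H2 H2']] := IH (if w is [::] then m.-1.+1 else m) t1.
  rewrite e2; case: (t (inord i)) e => l h r /= [_ ->] {e2 R1 e1}.
  by case: w => //=; case: m.
exists t2; split=> //.
  have -> : (2 * size (a :: w)).+1 = (1 + (2 * size w).+1).+1.
    by rewrite /= mulnS.
  by apply: runs_whileS R1 R2; case: e => ->.
rewrite H2' e2 rev_cons map_rcons cat_rcons.
by case: (t (inord i)) e => l h r /= [-> _].
Qed.

Lemma until_blank_map (w : seq G) n :
  until_blank (map Some w ++ nseq n None) = w.
Proof. by elim: w => [|a w /= ->] //; case: n. Qed.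

Lemma runs_unload i w (t : tapes) : i < k -> is_stack w (t (inord i)) ->
  exists t' : tapes, runs (unload i) t (2 * size w).+2 t' /\
                     word_of_tape (t' (inord i)) = rev w.
Proof.
move=> ik [m [n [e er]]]; have [t1 [R1 h1 r1]] := runs_skip_left ik e.
have [t2 [R2 e2]] := runs_shift i MoveRight t1.
exists t2; split; first by rewrite -addn1; apply: runs_seq R1 R2.
rewrite e2 inordK // eqxx; move: h1 r1; rewrite er {R1 e2}.
case: (t1 (inord i)) => l h r /= _ ->; rewrite -[RHS](until_blank_map _ n).
by rewrite /word_of_tape /=; case: (_ ++ _).
Qed.

Lemma compile_exec c st n st' : exec c st n st' -> bound c <= k ->
  forall t, stacks st t ->
  exists m t', [/\ m <= n, runs (compile c) t m t' & stacks st' t'].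
Proof.
elim=> {c st n st'}.
- move=> st _ t H; exists 1, t; split=> //.
  by rewrite -{2}[t]act_idle; apply: runs_one.
- move=> i a st /= ik t H; have [t1 [R1 H1]] := runs_push_top i H.
  exists (1 + 1), (act (on i (Some a, Stay) (scanned t1)) t1); split.
  + by [].
  + by apply: (runs_seq R1); apply: runs_one.
  + move=> j; rewrite act_on /upd; case: ifP (H1 j) => [/eqP<- /(_ a)|_ ->] //=.
- move=> i j a w st ij e /=; rewrite geq_max => /andP[ik jk] t H.
  have [t1 [R1 H1]] := runs_push_top j H.
  have ei : scanned t1 (inord i) = Some a.
    rewrite ffunE; have := H1 (inord i); rewrite inordK // (negPf ij) => ->.
    by rewrite (thead_stacks ik H) e.
  exists (1 + 1), (act (on j (Some a, Stay) (scanned t1)) t1); split.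
  + by [].
  + rewrite -ei; apply: (runs_seq R1).
    exact: (runs_one (fun sc => on j (sc (inord i), Stay) sc)).
  + move=> l; rewrite act_on /upd.
    by case: ifP (H1 l) => [/eqP<- /(_ a)|_ ->] //=.
- move=> i st /= ik t H.
  exists 1, (act (on i (None, MoveLeft) (scanned t)) t); split.
  + by [].
  + exact: runs_one.
  + move=> j; rewrite act_on /upd; case: eqP => [<-|] //=.
    case: (H j) => m [n []]; case: (t j) => l h r /= e ->.
    case: (st j) e => [|a w] /=.
      case: m => //= m [_ ->]; exists m.-1.+1, n.+1; split=> //=.
      by case: m.
    case=> _ ->; case: w => [|b w] /=.
      by exists m.-1.+1, n.+1; case: m.
    by exists m, n.+1.
- move=> c1 c2 st1 n st2 m st3 _ IH1 _ IH2 /=; rewrite geq_max => /andP[k1 k2].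
  move=> t /(IH1 k1)[n' [t1 [le1 R1]]] /(IH2 k2)[m' [t2 [le2 R2 H2]]].
  by exists (n' + m'), t2; split=> //; [apply: leq_add | apply: runs_seq R2].
- move=> i b c1 c2 st n st' _ IH /=; rewrite !geq_max => /and3P[ik k1 k2] t H.
  have kb : bound (if b (ohead (st i)) then c1 else c2) <= k by case: ifP.
  have [n' [t1 [le1 R1 H1]]] := IH kb _ H.
  exists n'.+1, t1; split=> //; apply: runs_if.
  by rewrite (thead_stacks ik H); case: ifP R1.
- move=> i c st e /=; rewrite !geq_max => /andP[ik kc] t H.
  exists 1, t; split=> //; apply: runs_while0.
  by rewrite (thead_stacks ik H) e.
- move=> i c st n st1 m st2 ne _ IH1 _ IH2 /= kk t H.
  move: (kk); rewrite !geq_max => /andP[ik kc].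
  have [n' [t1 [le1 R1 H1]]] := IH1 kc _ H.
  have [m' [t2 [le2 R2 H2]]] := IH2 kk _ H1.
  exists (n' + m').+1, t2; split=> //; first by rewrite ltnS leq_add.
  apply: runs_whileS R1 R2; rewrite (thead_stacks ik H).
  by case: (st i) ne.
- move=> c st n st' st0 m st0' _ IH e le e' kc t H.
  have [|n' [t1 [le1 R1 H1]]] := IH kc t.
    by move=> i; rewrite -e.
  exists n', t1; split=> //; first exact: leq_trans le.
  by move=> i; rewrite -e'.
Qed.

End Programs.

Lemma exec_frame (G : finType) (c : cmd G) st n st' i :
  exec c st n st' -> bound c <= i -> st' i = st i.
Proof.
have ne j : j < i -> (i == j) = false by case: ltngtP.
elim=> {c st n st'} //=.
- by move=> j a st /ne; rewrite /upd => ->.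
- by move=> j l a w st _ _; rewrite geq_max => /andP[_ /ne]; rewrite /upd => ->.
- by move=> j st /ne; rewrite /upd => ->.
- move=> c1 c2 st1 n st2 m st3 _ IH1 _ IH2; rewrite geq_max => /andP[b1 b2].
  by rewrite IH2 ?IH1.
- move=> j b c1 c2 st n st' _ IH; rewrite !geq_max => /and3P[_ b1 b2].
  by apply: IH; case: ifP.
- move=> j c st n st1 m st2 _ _ IH1 _ IH2 H; rewrite IH2 // IH1 //.
  by move: H; rewrite geq_max => /andP[].
- by move=> c st n st' st0 m st0' _ IH e _ e' /IH; rewrite e e'.
Qed.


(** * Polynomial bounds *)

Definition pb (f : nat -> nat) := exists d, forall n, f n <= n.+2 ^ d.

Lemma pb_id : pb id.
Proof. by exists 1 => n; rewrite expn1 -addn2 leq_addr. Qed.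

(** The base [n.+2] is at least 2, so constants and constant factors are absorbed by a larger
    exponent; a single exponent thus describes a polynomial bound. *)
Lemma pb_const c : pb (fun=> c).
Proof.
exists c => n; apply: leq_trans (ltnW (ltn_expl c (isT : 1 < 2))) _.
by case: c => // c; rewrite leq_exp2r.
Qed.

Lemma pb_mul f g : pb f -> pb g -> pb (fun n => f n * g n).
Proof. by move=> [d Hd] [e He]; exists (d + e) => n; rewrite expnD leq_mul. Qed.

Lemma pb_add f g : pb f -> pb g -> pb (fun n => f n + g n).
Proof.
move=> [d Hd] [e He]; exists (d + e).+1 => n; rewrite expnS.
apply: leq_trans (leq_mul (isT : 2 <= n.+2) (leqnn _)).
rewrite mul2n -addnn leq_add //.
  by apply: leq_trans (Hd n) _; rewrite leq_exp2l // leq_addr.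
by apply: leq_trans (He n) _; rewrite leq_exp2l // leq_addl.
Qed.

Lemma pb_comp f g : pb f -> pb g -> pb (fun n => f (g n)).
Proof.
move=> [d Hd] [e He]; exists (e.+2 * d) => n.
apply: leq_trans (Hd _) _; rewrite expnM; case: d {Hd} => // d.
rewrite leq_exp2r // -addn2 (leq_trans (leq_add (He n) (leqnn 2))) //.
have X0 : 0 < n.+2 ^ e by rewrite expn_gt0.
by rewrite !expnS; move: X0; set X := n.+2 ^ e; nia.
Qed.

Lemma pb_poly_bound f : pb f -> exists c d, forall n, f n <= poly_bound c d n.
Proof.
(* For [n > 0], [n + 2 <= 3 n] gives the factor [3 ^ d]; the additive constant covers [n = 0], where
   the bound is [2 ^ d]. *)
move=> [d Hd]; exists (3 ^ d), d => n; apply: leq_trans (Hd n) _.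
rewrite /poly_bound; case: n => [|n].
  by apply: leq_trans (leq_addl _ _); case: d {Hd} => // d; rewrite leq_exp2r.
apply: leq_trans (leq_addr _ _); rewrite -expnMn.
by case: d {Hd} => // d; rewrite leq_exp2r //; lia.
Qed.

(** * Loops and moves between stacks *)

Section Moves.
Variable G : finType.

(** The stores are indexed by the number of turns still to come, so the loop runs from [S n] down to
    [S 0]. *)
Lemma exec_loop (c : cmd G) i n T (S : nat -> store G) :
  (forall m, m < n -> S m.+1 i <> [::] /\ exec c (S m.+1) T (S m)) ->
  S 0 i = [::] -> exec (While i c) (S n) (n * T.+1).+1 (S 0).
Proof.
move=> H H0; elim: n H => [|n IH] H; first exact: E_while0.
have [ne e] := H n (ltnSn n).
rewrite mulSn -addnS addSn; apply: E_whileS e (IH _) => // m mn.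
exact/H/ltnW.
Qed.

Lemma exec_move i j (st : store G) : i != j ->
  exec (While i (Seq (Dup _ i j) (Pop _ i))) st (size (st i) * 4).+1
    (upd (upd st i [::]) j (rev (st i) ++ st j)).
Proof.
move=> ij; pose w := st i.
pose S m := upd (upd st i (drop (size w - m) w)) j
                (rev (take (size w - m) w) ++ st j).
have ji : (j == i) = false by rewrite eq_sym; apply: negbTE.
have Si m : S m i = drop (size w - m) w by rewrite /S /upd eqxx (negPf ij).
have e0 : S (size w) =1 st.
  move=> l; rewrite /S /upd subnn drop0 take0 /=.
  by case: eqP => [->//|_]; case: eqP => [->|].
have e1 : S 0 =1 upd (upd st i [::]) j (rev w ++ st j).
  by move=> l; rewrite /S /upd subn0 drop_size take_size.
apply: (E_conv (st0 := S (size w)) (st0' := S 0) _ _ (leqnn _) e1) => //.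
apply: exec_loop => [m mw|]; last by rewrite Si subn0 drop_size.
have lt : size w - m.+1 < size w by lia.
have eS : size w - m = (size w - m.+1).+1 by lia.
case ew : w => [|x0 w'] /=; first by rewrite ew in mw.
have eD : S m.+1 i = nth x0 w (size w - m.+1) :: S m i.
  by rewrite !Si eS (drop_nth x0).
split; first by rewrite eD.
pose st1 := upd (S m.+1) j (nth x0 w (size w - m.+1) :: S m.+1 j).
apply: (E_conv (E_seq (E_dup ij eD) (E_pop i st1))) => // l.
rewrite /st1 /upd; case: eqP => [->|/eqP li].
  by rewrite (negPf ij) eD.
case: eqP => [->|/eqP lj]; last by rewrite /S /upd (negPf lj) (negPf li).
by rewrite /S /upd eqxx eS (take_nth x0) // rev_rcons.
Qed.

End Moves.

Lemma iter_fix (X : Type) (h : X -> X) n x : h x = x -> iter n h x = x.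
Proof. by move=> e; elim: n => //= n ->. Qed.

Lemma polytime_exec (A B : finType) (f : seq A -> seq B)
    (c : cmd (option (A + B))) T :
  pb T -> (forall x, size (f x) <= T (size x)) ->
  (forall x, exists st',
    exec c (fun i => if i == 0 then map (Some \o inl) (rev x) else [::])
      (T (size x)) st' /\ st' 1 = map (Some \o inr) (f x)) ->
  polytime f.
Proof.
(* The output is read on the last tape, numbered [K]: [c] never touches it, and it differs from the
   input stack 0 and the result stack 1. Moving the result there reverses it, which [unload]
   undoes. *)
move=> pT szf H; pose K := maxn 2 (bound c).
pose c' := Seq c (While 1 (Seq (Dup _ 1 K) (Pop _ 1))).
have K1 : 1 != K by rewrite neq_ltn leq_max.
have bK : bound c <= K by rewrite leq_maxr.
pose P := fseq (load _ K) (fseq (compile K c') (unload _ K K)).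
pose T' n := 2 * n + 7 * T n + 9.
have [d' [d Hd]] : exists c d, forall n, T' n <= poly_bound c d n.
  apply: pb_poly_bound; apply: pb_add (pb_const _).
  by apply: pb_add; apply: pb_mul => //; [apply: pb_const|apply: pb_id|apply: pb_const].
exists (option (A + B)), (Some \o inl), (Some \o inr), (machine_of P), d', d.
split; [by move=> a b []|by move=> a b []|move=> x].
have [st1 [E1 e1]] := H x.
have E2 := exec_move st1 K1.
have [|t1 [R1 H1]] := @runs_load _ K (map (Some \o inl) x)
  (ctapes (initial (machine_of P) (map (Some \o inl) x))).
  by move=> j; rewrite ffunE.
rewrite size_map in R1.
rewrite -map_rev in H1.
have [|n2 [t2 [le2 R2 H2]]] := compile_exec (k' := K) (E_seq E1 E2) _ H1.
  by rewrite /= -/K; lia.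
have [t3 [R3 e3]] := runs_unload (ltnSn K) (H2 (inord K)).
have szw : size (f x) <= T (size x) := szf x.
move: R3 e3; rewrite inordK // /upd eqxx (exec_frame E1 bK) e1.
have -> /= : (K == 0) = false by apply/negbTE; rewrite -lt0n; lia.
rewrite cats0 revK size_rev size_map => R3 e3.
have /runs_machine E := runs_seq R1 (runs_seq R2 R3).
set n := _ + _ in E.
have le : n <= poly_bound d' d (size x).
  apply: leq_trans (Hd _); move: le2; rewrite /n /T' e1 size_map; lia.
rewrite /computes_in -(subnK le) iterD [initial _]/initial [iter n _ _]E.
rewrite iter_fix //; split=> //; rewrite /output /= -e3; congr word_of_tape.
by congr (t3 _); apply: val_inj; rewrite /= inordK.
Qed.

(** * Functions definable in polynomial time *)

(* Environments bind variables by de Bruijn indices. *)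
Definition env := nat -> nat.
Definition tail (r : env) : env := fun j => r j.+1.
Definition scons (m : nat) (r : env) : env := fun j => if j is j'.+1 then r j' else m.

Lemma iota0S n : iota 0 n.+1 = rcons (iota 0 n) n.
Proof. by rewrite -addn1 iotaD cats1. Qed.

Section Definable.
Variables A B : finType.
Notation G := (option (A + B)).
(* The tape alphabet is that of the input and output words, together with the
   unary digit [None : G]; the blank is [None : option G]. *)
Notation inA := (fun a : A => Some (inl a) : G).
Notation one := (None : G).
Implicit Types (x : seq A) (r : env) (loc : nat -> nat) (st : store G).

(* The input is on stack 0, variable [j] is the height of stack [loc j], the
   result goes to [dst], and the stacks from [s] on are empty scratch space. *)
Record ready x r loc s dst st : Prop := Ready {
  ready_input : st 0 = map inA (rev x);
  ready_var : forall j, size (st (loc j)) = r j;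
  ready_loc : forall j, loc j < s;
  ready_dst : forall j, loc j != dst;
  ready_dst0 : 0 < dst;
  ready_dsts : dst < s;
  ready_scratch : forall i, s <= i -> st i = [::]
}.

Definition add dst n st : store G := upd st dst (nseq n one ++ st dst).

(** The result is pushed on top of what [dst] already holds, so that addition is sequencing and a
    bounded sum is a loop with a fixed [dst]. One [N] bounds the input length and all variables; as
    [T N] also bounds the value, this value can serve as the range of a further variable. *)
Definition computes (f : seq A -> env -> nat) (T : nat -> nat)
    (c : (nat -> nat) -> nat -> nat -> cmd G) : Prop :=
  forall x r N, size x <= N -> (forall j, r j <= N) ->
  f x r <= T N /\
  forall loc s dst st, ready x r loc s dst st ->
    exec (c loc s dst) st (T N) (add dst (f x r) st).

Definition dfn (f : seq A -> env -> nat) : Prop :=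
  exists T c, pb T /\ computes f T c.

Lemma dfn_ext f g : (forall x r, f x r = g x r) -> dfn f -> dfn g.
Proof.
move=> e [T [c [pT H]]]; exists T, c; split=> // x r N hx hr.
by rewrite -e; apply: H.
Qed.

Lemma dfn_tail f : dfn f -> dfn (fun x r => f x (tail r)).
Proof.
move=> [T [c [pT H]]]; exists T, (fun loc => c (tail loc)); split=> // x r N hx hr.
have [||le E] := H x (tail r) N; rewrite ?/tail //.
split=> // loc s dst st [h1 h2 h3 h4 h5 h6 h7].
by apply: E; split=> // j; apply: h2.
Qed.

Lemma dfn_one : dfn (fun _ _ => 1).
Proof.
exists (fun=> 2), (fun loc s dst => Push dst one); split; first exact: pb_const.
by move=> x r N _ _; split=> // loc s dst st _; apply: E_push.
Qed.

Lemma ready_inner x r loc s dst st : ready x r loc s dst st ->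
  ready x r loc s.+1 s st.
Proof.
move=> [h1 h2 h3 h4 h5 h6 h7]; split=> //.
- by move=> j; apply/ltnW/h3.
- by move=> j; rewrite neq_ltn h3.
- by apply: leq_ltn_trans h6.
- by move=> i /ltnW; apply: h7.
Qed.

Lemma ready_add x r loc s dst st n : ready x r loc s dst st ->
  ready x r loc s dst (add dst n st).
Proof.
move=> [h1 h2 h3 h4 h5 h6 h7]; split=> //.
- by rewrite /add /upd; case: eqP h5 => // <-.
- by move=> j; rewrite /add /upd (negPf (h4 j)).
- move=> i si; rewrite /add /upd; case: eqP => [e|_]; last exact: h7.
  by rewrite e leqNgt h6 in si.
Qed.

Lemma ready_cons x r loc s dst st w : ready x r loc s dst st ->
  ready x (scons (size w) r) (scons s loc) s.+1 dst (upd st s w).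
Proof.
move=> [h1 h2 h3 h4 h5 h6 h7]; split=> //.
- by rewrite /upd; case: eqP h6 => // <-.
- case=> [|j] /=; first by rewrite /upd eqxx.
  by rewrite /upd; have := h3 j; case: eqP => [->|//]; rewrite ltnn.
- by case=> [|j] //=; rewrite ltnS ltnW.
- by case=> [|j] //=; rewrite neq_ltn h6 orbT.
- exact: ltnW.
- move=> i si; rewrite /upd; case: eqP => [e|_]; first by rewrite e ltnn in si.
  exact/h7/ltnW.
Qed.

Lemma upd_add st s dst n w : s != dst ->
  add dst n (upd st s w) =1 upd (add dst n st) s w.
Proof.
move=> ne i; rewrite /add /upd; case: eqP => // ->.
by rewrite eq_sym (negPf ne).
Qed.

Fixpoint loop_sum (P : pred (option G)) (g : nat -> nat) (w : seq G) : nat :=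
  if w is a :: w' then
    (if P (Some a) then g (size w') else 0) + loop_sum P g w'
  else 0.

(** After each pop the height of stack [s] is the index of the current turn, so the stack that
    controls the loop is also its bound variable, numbered 0. For a copy of the input, which has its
    last letter on top, this height is the position of the popped letter. *)
Definition loop (P : pred (option G)) (c : (nat -> nat) -> nat -> nat -> cmd G)
    loc s dst : cmd G :=
  While s (IfTop s P (Seq (Pop G s) (c (scons s loc) s.+1 dst)) (Pop G s)).

Lemma loop_sum_le P g w b : (forall i, i < size w -> g i <= b) ->
  loop_sum P g w <= size w * b.
Proof.
elim: w => //= a w IH H; rewrite mulSn leq_add //.
  by case: ifP => // _; apply: H.
by apply: IH => i iw; apply/H/ltnW.
Qed.

Lemma exec_loop_sum P f T c x r N loc s dst st w :
  computes f T c -> size x <= N -> (forall j, r j <= N) -> size w <= N ->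
  ready x r loc s dst st ->
  exec (loop P c loc s dst) (upd st s w) (size w * (T N + 3)).+1
    (add dst (loop_sum P (fun i => f x (scons i r)) w) st).
Proof.
move=> H hx hr; have ne : ready x r loc s dst st -> s != dst.
  by case=> *; rewrite neq_ltn orbC; apply/orP; left.
elim: w st ne => [|a w IH] st ne hw R.
  apply: (E_conv (E_while0 _ (st := upd st s [::]) _)) => //.
    by rewrite /upd eqxx.
  move=> i; rewrite /add /upd /=; case: eqP => [->|_]; last by case: eqP => [->|].
  rewrite eq_sym; have := ne R; rewrite eq_sym => /negPf ->.
  by have [_ _ _ _ _ _ ->] := R.
pose n := if P (Some a) then f x (scons (size w) r) else 0.
pose st1 := upd (add dst n st) s w.
have E1 : exec (IfTop s P (Seq (Pop G s) (c (scons s loc) s.+1 dst)) (Pop G s))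
    (upd st s (a :: w)) (T N + 2) st1.
  have e0 : upd (upd st s (a :: w)) s (behead (upd st s (a :: w) s)) =1 upd st s w.
    by move=> i; rewrite /upd eqxx; case: eqP.
  have E0 : exec (Pop G s) (upd st s (a :: w)) 1 (upd st s w).
    exact: E_conv (E_pop s (upd st s (a :: w))) _ _ e0.
  rewrite addn2; apply: E_if; rewrite {1}/upd eqxx /= /st1 /n.
  case: (P _).
    rewrite -add1n; apply: E_seq E0 _.
    have [|_ E] := H x (scons (size w) r) N hx.
    - by case=> [|j] //=; apply: ltnW.
    - exact: E_conv (E _ _ _ _ (ready_cons w R)) _ _ (upd_add _ _ _ (ne R)).
  apply: (E_conv E0) => // i.
  by rewrite /add /upd; case: eqP => // _; case: eqP => [->|].
have R1 := ready_add n R.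
have E2 := IH (add dst n st) (fun=> ne R) (ltnW hw) R1.
apply: (E_conv (E_whileS _ E1 E2)) => //.
- by rewrite /upd eqxx.
- by rewrite /= mulSn; lia.
- move=> i; rewrite /add /upd eqxx /=; case: eqP => // _.
  by rewrite catA -nseqD addnC.
Qed.

Lemma loop_sum_predT g w :
  loop_sum predT g w = \sum_(i <- iota 0 (size w)) g i.
Proof.
elim: w => [|a w IH]; first by rewrite big_nil.
by rewrite /= IH -[RHS]/(\sum_(i <- iota 0 (size w).+1) g i) iota0S big_rcons addnC.
Qed.

Lemma loop_sum_input P g x :
  loop_sum (fun o => if o is Some (Some (inl a)) then P a else false) g
    (map inA (rev x))
  = \sum_(i <- iota 0 (size x)) oapp P false (onth x i) * g i.
Proof.
elim/last_ind: x => [|x a IH]; first by rewrite big_nil.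
rewrite rev_rcons /= IH size_map size_rev size_rcons iota0S big_rcons /=.
rewrite addnC; congr (_ + _); last first.
  by rewrite onthE map_rcons nth_rcons size_map ltnn eqxx /=; case: (P a); rewrite ?mul1n.
apply: eq_big_seq => i; rewrite mem_iota /= add0n => ix.
by rewrite !onthE map_rcons nth_rcons size_map ix.
Qed.

Lemma exec_spill i s t u st : i != t -> s != t -> i != s -> st t = u ->
  exec (While t (Seq (Dup G t s) (Seq (Dup G t i) (Pop G t)))) st
    (size u * 6).+1
    (upd (upd (upd st t [::]) s (rev u ++ st s)) i (rev u ++ st i)).
Proof.
move=> it; rewrite eq_sym => ts; rewrite eq_sym => si.
elim: u st => [|a u IH] st e.
  apply: (E_conv (E_while0 _ e)) => // l.
  by rewrite /upd; case: eqP => [->|] //; case: eqP => [->|] //; case: eqP => [->|].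
pose st1 := upd st s (a :: st s).
have e1 : st1 t = a :: u by rewrite /st1 /upd (negPf ts).
pose st2 := upd st1 i (a :: st1 i).
have e2 : st2 t = a :: u by rewrite /st2 /upd eq_sym (negPf it).
have e3 : upd st2 t (behead (st2 t)) t = u by rewrite /upd eqxx e2.
have ti : t != i by rewrite eq_sym.
have st' : s != t by rewrite eq_sym.
have := E_seq (E_dup ts e) (E_seq (E_dup ti e1) (E_pop t st2)).
move=> /E_whileS /(_ (IH _ e3)) H; apply: (E_conv (H _)) => //.
- by rewrite e.
- move=> l; rewrite /st2 /st1 /upd !eqxx (negPf it) (negPf si) (negPf st').
  rewrite (negPf ti) (eq_sym i s) (negPf si) !rev_cons !cat_rcons.
  case: (l =P i) => // _; case: (l =P s) => // _.
  by case: (l =P t).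
Qed.

(** Reading a stack consumes it: its content goes to [s.+1] in reverse order, and from there back to
    both [i] and [s] in the original order. *)
Definition copy i s : cmd G :=
  Seq (While i (Seq (Dup G i s.+1) (Pop G i)))
    (While s.+1 (Seq (Dup G s.+1 s) (Seq (Dup G s.+1 i) (Pop G s.+1)))).

Lemma exec_copy i s st : i < s -> st s = [::] -> st s.+1 = [::] ->
  exec (copy i s) st (size (st i) * 10 + 2) (upd st s (st i)).
Proof.
move=> lt e e1.
have is1 : i != s.+1 by rewrite neq_ltn ltnW.
have is' : i != s by rewrite neq_ltn lt.
have ss1 : s != s.+1 by rewrite neq_ltn ltnSn.
have E1 := exec_move st is1.
have E2 := @exec_spill i s s.+1 _ _ is1 ss1 is' erefl.
apply: (E_conv (E_seq E1 (E2 _))) => //.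
  by rewrite /upd eqxx e1 cats0 size_rev; lia.
move=> l; rewrite /upd !eqxx e1 cats0 revK (negPf is1) (negPf ss1) e !cats0.
case: (l =P i) => [->|]; first by rewrite (negPf is').
case: (l =P s) => [_|ls] _; first by case: ifP; rewrite cats0.
by case: (l =P s.+1) => [->|].
Qed.

(** Only the height of a variable's stack counts, since in a loop over the input this stack holds
    letters. Hence the value is produced by a loop that pushes one unary digit per letter. *)
Lemma dfn_var j : dfn (fun _ r => r j).
Proof.
pose cone := fun (_ : nat -> nat) (_ dst : nat) => Push dst one.
have Hone : computes (fun _ _ => 1) (fun=> 2) cone.
  by move=> x r N _ _; split=> // loc s dst st _; apply: E_push.
exists (fun N => N * 15 + 3), (fun loc s dst =>
  Seq (copy (loc j) s) (loop predT cone loc s dst)); split.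
  by apply: pb_add (pb_const _); apply: pb_mul (pb_const _); apply: pb_id.
move=> x r N hx hr; split; first by have := hr j; lia.
move=> loc s dst st R; have [_ h2 h3 _ _ _ h7] := R.
have E1 := exec_copy (h3 j) (h7 _ (leqnn s)) (h7 _ (leqnSn s)).
have hw : size (st (loc j)) <= N by rewrite h2.
have E2 := exec_loop_sum predT Hone hx hr hw R.
apply: (E_conv (E_seq E1 E2)) => //; first by have := hr j; rewrite h2; lia.
by move=> i; rewrite loop_sum_predT sum1_size size_iota h2.
Qed.

Lemma dfn_add f g : dfn f -> dfn g -> dfn (fun x r => f x r + g x r).
Proof.
move=> [T1 [c1 [p1 H1]]] [T2 [c2 [p2 H2]]].
exists (fun N => T1 N + T2 N), (fun loc s dst => Seq (c1 loc s dst) (c2 loc s dst)).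
split; first exact: pb_add.
move=> x r N hx hr; have [le1 E1] := H1 x r N hx hr.
have [le2 E2] := H2 x r N hx hr; split; first exact: leq_add.
move=> loc s dst st R; have {}E2 := E2 _ _ _ _ (ready_add (f x r) R).
apply: (E_conv (E_seq (E1 _ _ _ _ R) E2)) => // i.
by rewrite /add /upd; case: eqP => // _; rewrite eqxx catA -nseqD addnC.
Qed.

Lemma dfn_sum f g : dfn f -> dfn (fun x r => g x (tail r) (r 0)) ->
  dfn (fun x r => \sum_(i <- iota 0 (f x r)) g x r i).
Proof.
move=> [T1 [c1 [p1 H1]]] [T2 [c2 [p2 H2]]].
exists (fun N => T1 N + T1 N * (T2 (N + T1 N) + 3) + 1),
  (fun loc s dst => Seq (c1 loc s.+1 s) (loop predT c2 loc s dst)).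
split.
  apply: pb_add (pb_const _); apply: pb_add => //; apply: pb_mul => //.
  apply: pb_add (pb_const _); apply: (pb_comp p2); apply: pb_add => //.
  exact: pb_id.
move=> x r N hx hr; have [le1 E1] := H1 x r N hx hr.
have hx' : size x <= N + T1 N by lia.
have hr' j : r j <= N + T1 N by have := hr j; lia.
split.
  have {1}-> : f x r = size (nseq (f x r) one) by rewrite size_nseq.
  rewrite -loop_sum_predT; apply: (@leq_trans (T1 N * T2 (N + T1 N))); last lia.
  apply: leq_trans (loop_sum_le _ (b := T2 (N + T1 N)) _) _.
    move=> i; rewrite size_nseq => iw.
    have [|le _] := H2 x (scons i r) (N + T1 N) hx'; last exact: le.
    by case=> [|j] //=; lia.
  by rewrite size_nseq leq_mul2r le1 orbT.
move=> loc s dst st R; have {}E1 := E1 _ _ _ _ (ready_inner R).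
have hw : size (nseq (f x r) one) <= N + T1 N by rewrite size_nseq; lia.
have E2 := exec_loop_sum predT H2 hx' hr' hw R.
have e0 : add s (f x r) st =1 upd st s (nseq (f x r) one).
  by move=> i; rewrite /add /upd; case: R => _ _ _ _ _ _ ->; rewrite ?cats0.
apply: (E_conv (E_seq (E_conv E1 (frefl _) (leqnn _) e0) E2)) => //.
  by have := leq_mul le1 (leqnn (T2 (N + T1 N) + 3)); rewrite size_nseq; lia.
by move=> i; rewrite loop_sum_predT size_nseq.
Qed.

Lemma dfn_sum_input P g : dfn (fun x r => g x (tail r) (r 0)) ->
  dfn (fun x r => \sum_(i <- iota 0 (size x)) oapp P false (onth x i) * g x r i).
Proof.
move=> [T2 [c2 [p2 H2]]].
set P' := fun o : option G => if o is Some (Some (inl a)) then P a else false.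
exists (fun N => N * 10 + N * (T2 N + 3) + 3),
  (fun loc s dst => Seq (copy 0 s) (loop P' c2 loc s dst)).
split.
  apply: pb_add (pb_const _); apply: pb_add; apply: pb_mul;
    do ?[exact: pb_id|exact: pb_const].
  by apply: pb_add (pb_const _).
move=> x r N hx hr.
have szw : size (map inA (rev x)) = size x by rewrite size_map size_rev.
split.
  rewrite -loop_sum_input; apply: (@leq_trans (N * T2 N)); last lia.
  apply: leq_trans (loop_sum_le _ (b := T2 N) _) _.
    move=> i; rewrite szw => iw.
    have [|le _] := H2 x (scons i r) N hx; last exact: le.
    by case=> [|j] //=; lia.
  by rewrite szw leq_mul2r hx orbT.
move=> loc s dst st R; have [h1 _ _ _ h5 h6 h7] := R.
have E1 := exec_copy (ltn_trans h5 h6) (h7 _ (leqnn s)) (h7 _ (leqnSn s)).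
have hw : size (st 0) <= N by rewrite h1 szw.
have E2 := exec_loop_sum P' H2 hx hr hw R.
apply: (E_conv (E_seq E1 E2)) => //.
  by rewrite h1 szw; move: hx; set n := size x => ?; nia.
by move=> i; rewrite -loop_sum_input h1.
Qed.

(** Popping an empty stack does nothing, so cancelling one unary number against another leaves their
    truncated difference. *)
Lemma exec_cancel s t u st : s != t -> st t = u ->
  exec (While t (Seq (Pop G t) (Pop G s))) st (size u * 3).+1
    (upd (upd st t [::]) s (drop (size u) (st s))).
Proof.
move=> ne; elim: u st => [|a u IH] st e.
  apply: (E_conv (E_while0 _ e)) => // l.
  by rewrite /upd drop0; case: eqP => [->|] //; case: eqP => [->|].
have := E_seq (E_pop t st) (E_pop s _).
set st1 := upd (upd _ _ _) _ _ => E1.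
have e1 : st1 t = u by rewrite /st1 /upd eq_sym (negPf ne) eqxx e.
apply: (E_conv (E_whileS _ E1 (IH _ e1))) => //.
- by rewrite e.
- move=> l; rewrite /st1 /upd eqxx (negPf ne).
  case: (l =P s) => [_|ls]; first by case: (st s).
  by case: (l =P t).
Qed.

Lemma dfn_sub f g : dfn f -> dfn g -> dfn (fun x r => f x r - g x r).
Proof.
move=> [T1 [c1 [p1 H1]]] [T2 [c2 [p2 H2]]].
pose cone := fun (_ : nat -> nat) (_ dst : nat) => Push dst one.
have Hone : computes (fun _ _ => 1) (fun=> 2) cone.
  by move=> x r N _ _; split=> // loc s dst st _; apply: E_push.
exists (fun N => T1 N * 6 + T2 N * 4 + 2),
  (fun loc s dst => Seq (c1 loc s.+1 s) (Seq (c2 loc s.+2 s.+1)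
    (Seq (While s.+1 (Seq (Pop G s.+1) (Pop G s))) (loop predT cone loc s dst)))).
split.
  apply: pb_add (pb_const _); apply: pb_add; apply: pb_mul => //; exact: pb_const.
move=> x r N hx hr; have [le1 E1] := H1 x r N hx hr.
have [le2 E2] := H2 x r N hx hr; split; first by lia.
move=> loc s dst st R; have Ri := ready_inner R.
have {}E1 := E1 _ _ _ _ Ri.
have {}E2 := E2 _ _ _ _ (ready_inner (ready_add (f x r) Ri)).
have ss1 : s != s.+1 by rewrite neq_ltn ltnSn.
have E3 := @exec_cancel s s.+1 _ _ ss1 erefl.
set w := nseq (f x r - g x r) one.
have [hx' hr'] : size x <= N + T1 N /\ forall j, r j <= N + T1 N.
  by split; [|move=> j; have := hr j]; lia.
have hw : size w <= N + T1 N by rewrite size_nseq; lia.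
have E4 := exec_loop_sum predT Hone hx' hr' hw R.
have [hs hs1] : st s = [::] /\ st s.+1 = [::].
  by case: R => _ _ _ _ _ _ h7; rewrite !h7.
have e0 : upd (upd (add s.+1 (g x r) (add s (f x r) st)) s.+1 [::]) s
    (drop (size (add s.+1 (g x r) (add s (f x r) st) s.+1))
       (add s.+1 (g x r) (add s (f x r) st) s)) =1 upd st s w.
  move=> i; rewrite /add /upd !eqxx (negPf ss1) (eq_sym s.+1 s) (negPf ss1) hs hs1.
  rewrite !cats0 size_nseq drop_nseq.
  by case: (i =P s) => // _; case: (i =P s.+1) => // ->.
have e1 : size (add s.+1 (g x r) (add s (f x r) st) s.+1) = g x r.
  rewrite /add /upd !eqxx (eq_sym s.+1 s) (negPf ss1) hs1 cats0.
  exact: size_nseq.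
have E34 := E_seq (E_conv (E3 _) (frefl _) (leqnn _) e0) E4.
apply: (E_conv (E_seq E1 (E_seq E2 E34))) => //.
  by rewrite e1 size_nseq; lia.
by move=> i; rewrite loop_sum_predT sum1_size size_iota size_nseq.
Qed.


(** The pushed letter is fixed in the program text, so [out] is unrolled into a decision tree of
    depth [K] that consumes the number on stack [i] digit by digit. *)
Fixpoint emit (out : nat -> B) i j K : cmd G :=
  if K is K'.+1 then
    IfTop i isSome (Seq (Pop G i) (emit (out \o S) i j K')) (Push j (Some (inr (out 0))))
  else Push j (Some (inr (out 0))).

Lemma exec_emit out i j K v st : i != j -> v <= K -> st i = nseq v one ->
  exec (emit out i j K) st (2 * K + 2)
    (upd (upd st i [::]) j (Some (inr (out v)) :: st j)).
Proof.
move=> ij; elim: K v out st => [|K IH] [|v] out st // vK e.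
- apply: (E_conv (E_push j _ st)) => // l.
  by rewrite /upd; case: eqP => // _; case: eqP => [->|].
- have E1 : exec (emit out i j K.+1) st 3 (upd st j (Some (inr (out 0)) :: st j)).
    by apply: E_if; rewrite e; apply: E_push.
  apply: (E_conv E1) => //; first by lia.
  by move=> l; rewrite /upd; case: eqP => // _; case: eqP => [->|].
- have e1 : upd st i (behead (st i)) i = nseq v one by rewrite /upd eqxx e.
  have E1 := E_seq (E_pop i st) (IH v (out \o S) _ vK e1).
  have E2 := @E_if _ i isSome _ (Push j (Some (inr (out 0)))) st _ _.
  rewrite e /= in E2; apply: (E_conv (E2 _ _ _ E1)) => //; first by lia.
  move=> l; rewrite /upd (eq_sym j) (negPf ij).
  by case: (l =P j) => // _; case: (l =P i).
Qed.

Lemma polytime_mkseq (out : nat -> B) K (len : seq A -> nat) (sym : seq A -> nat -> nat) :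
  dfn (fun x _ => len x) -> dfn (fun x r => sym x (r 0)) ->
  (forall x i, i < len x -> sym x i <= K) ->
  polytime (fun x => mkseq (fun i => out (sym x i)) (len x)).
Proof.
move=> [T1 [c1 [p1 H1]]] [T2 [c2 [p2 H2]]] HK.
(* Stack 1 collects the output, stack 3 is both the counter and variable 0, and stack 4 receives the
   code of the letter. Stack 2 stays empty and stands for all other variables. The counter runs
   downwards, so the first letter ends on top of stack 1. *)
pose body := Seq (Pop G 3) (Seq (c2 (scons 3 (fun=> 2)) 5 4) (emit out 4 1 K)).
pose c := Seq (c1 (fun=> 2) 4 3) (While 3 body).
pose T n := T1 n + (T1 n * (T2 (n + T1 n) + 2 * K + 4)).+1.
have pT : pb T.
  have p3 : pb (fun n => T2 (n + T1 n)).
    by apply: (pb_comp p2); apply: pb_add => //; exact: pb_id.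
  apply: pb_add => //; apply: (pb_comp (f := S)); first by exists 1 => n; lia.
  apply: pb_mul => //; apply: pb_add (pb_const _); apply: pb_add (pb_const _).
  exact: p3.
have pos x : len x <= T1 (size x).
  by have [|//] := H1 x (fun=> 0) (size x) (leqnn _).
apply: (polytime_exec (c := c) pT) => x.
  by rewrite size_mkseq; apply: leq_trans (pos x) _; rewrite leq_addr.
pose N := size x + T1 (size x).
pose S m : store G := fun i => if i == 0 then map inA (rev x)
  else if i == 3 then nseq m one
  else if i == 1 then [seq Some (inr (out (sym x i))) | i <- iota m (len x - m)]
  else [::].
exists (S 0); split; last by rewrite /S /= subn0 -map_comp.
have [|_ E1] := H1 x (fun=> 0) (size x) (leqnn _); first by [].
have {}E1 : exec (c1 (fun=> 2) 4 3) (fun i => if i == 0 then map inA (rev x) else [::])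
    (T1 (size x)) (S (len x)).
  apply: (E_conv (E1 (fun=> 2) 4 3 (fun i => if i == 0 then map inA (rev x) else [::]) _)) => //.
    by split=> // i; case: i.
  by move=> i; rewrite /add /upd /S subnn /= cats0; case: i => [|[|[|[|i]]]].
have E2 m : m < len x -> S m.+1 3 <> [::] /\
    exec body (S m.+1) (T2 N + 2 * K + 3) (S m).
  move=> mx; split=> //.
  have [||_ E] := H2 x (scons m (fun=> 0)) N.
  - by rewrite leq_addr.
  - case=> [|j] //=; apply: (leq_trans (ltnW mx)).
    by apply: leq_trans (pos x) _; rewrite leq_addl.
  pose st1 := upd (S m.+1) 3 (nseq m one).
  have {}E : exec (c2 (scons 3 (fun=> 2)) 5 4) st1 (T2 N) (add 4 (sym x m) st1).
    apply: E; split=> //.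
    + by case=> [|j] //; rewrite /st1 /upd /= size_nseq.
    + by case.
    + by case.
    + by move=> i; rewrite /st1 /upd /S; case: i => [|[|[|[|i]]]].
  have e4 : add 4 (sym x m) st1 4 = nseq (sym x m) one by rewrite /add /upd /= cats0.
  have E3 := exec_emit out (isT : 4 != 1) (HK x m mx) e4.
  apply: (E_conv (E_seq (E_pop 3 _) (E_seq E E3))) => //; first by lia.
  have em : len x - m = (len x - m.+1).+1 by lia.
  by move=> i; rewrite /add /st1 /upd /S em; case: i => [|[|[|[|[|i]]]]].
have E3 := exec_loop E2 erefl.
apply: (E_conv (E_seq E1 E3)) => //.
have := leq_mul (pos x) (leqnn (T2 N + 2 * K + 4)); rewrite /T -/N; lia.
Qed.

End Definable.

Arguments dfn {A} B f.
Notation dfnb B P := (dfn B (fun x r => nat_of_bool (P x r))).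

(** * Arithmetic, bounded quantifiers and substitution *)

Section Closure.
Variables A B : finType.
Implicit Types (f g : seq A -> env -> nat) (P Q : seq A -> env -> bool).

Lemma dfn_const c : dfn B (fun (_ : seq A) _ => c).
Proof.
elim: c => [|c IH]; last first.
  by apply: dfn_ext (dfn_add IH (dfn_one A B)) => x r; rewrite addn1.
by apply: dfn_ext (dfn_sub (dfn_one A B) (dfn_one A B)) => x r; rewrite subnn.
Qed.

Lemma dfn_succ f : dfn B f -> dfn B (fun x r => (f x r).+1).
Proof.
by move=> H; apply: dfn_ext (dfn_add H (dfn_one A B)) => x r; rewrite addn1.
Qed.

Lemma dfn_mul f g : dfn B f -> dfn B g -> dfn B (fun x r => f x r * g x r).
Proof.
move=> Hf Hg; apply: dfn_ext (dfn_sum (g := fun x r _ => g x r) Hf _).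
  by move=> x r; rewrite big_const_seq count_predT size_iota iter_addn_0 mulnC.
exact: (dfn_tail Hg).
Qed.

Lemma dfn_exp f d : dfn B f -> dfn B (fun x r => f x r ^ d).
Proof.
move=> H; elim: d => [|d IH]; first exact: (dfn_const 1).
by apply: dfn_ext (dfn_mul H IH) => x r; rewrite expnS.
Qed.

Lemma dfn_leq f g : dfn B f -> dfn B g -> dfnb B (fun x r => f x r <= g x r).
Proof.
move=> Hf Hg; apply: dfn_ext (dfn_sub (dfn_const 1) (dfn_sub Hf Hg)) => x r.
by rewrite -[f x r <= _]subn_eq0; case: (f x r - g x r).
Qed.

Lemma dfn_eq f g : dfn B f -> dfn B g -> dfnb B (fun x r => f x r == g x r).
Proof.
move=> Hf Hg; apply: dfn_ext (dfn_mul (dfn_leq Hf Hg) (dfn_leq Hg Hf)) => x r.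
by rewrite mulnb -eqn_leq.
Qed.

Lemma dfn_and P Q : dfnb B P -> dfnb B Q -> dfnb B (fun x r => P x r && Q x r).
Proof.
by move=> HP HQ; apply: dfn_ext (dfn_mul HP HQ) => x r; rewrite mulnb.
Qed.

Lemma dfn_not P : dfnb B P -> dfnb B (fun x r => ~~ P x r).
Proof.
by move=> H; apply: dfn_ext (dfn_sub (dfn_const 1) H) => x r; case: (P x r).
Qed.

Lemma dfn_or P Q : dfnb B P -> dfnb B Q -> dfnb B (fun x r => P x r || Q x r).
Proof.
move=> HP HQ; apply: dfn_ext (dfn_not (dfn_and (dfn_not HP) (dfn_not HQ))).
by move=> x r; rewrite negb_and !negbK.
Qed.

Lemma dfn_imply P Q : dfnb B P -> dfnb B Q -> dfnb B (fun x r => P x r ==> Q x r).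
Proof.
move=> HP HQ; apply: dfn_ext (dfn_or (dfn_not HP) HQ).
by move=> x r; rewrite implybE.
Qed.

Lemma dfn_eqb P Q : dfnb B P -> dfnb B Q -> dfnb B (fun x r => P x r == Q x r).
Proof.
move=> HP HQ; apply: dfn_ext (dfn_eq HP HQ) => x r.
by case: (P x r); case: (Q x r).
Qed.

Lemma dfn_if P f g : dfnb B P -> dfn B f -> dfn B g ->
  dfn B (fun x r => if P x r then f x r else g x r).
Proof.
move=> HP Hf Hg.
apply: dfn_ext (dfn_add (dfn_mul HP Hf) (dfn_mul (dfn_not HP) Hg)) => x r.
by case: (P x r); rewrite mul1n ?addn0.
Qed.

Lemma dfn_ifb P Q1 Q2 : dfnb B P -> dfnb B Q1 -> dfnb B Q2 ->
  dfnb B (fun x r => if P x r then Q1 x r else Q2 x r).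
Proof.
by move=> HP H1 H2; apply: dfn_ext (dfn_if HP H1 H2) => x r; case: (P x r).
Qed.

Lemma dfn_has f (Q : seq A -> env -> nat -> bool) : dfn B f ->
  dfnb B (fun x r => Q x (tail r) (r 0)) ->
  dfnb B (fun x r => has (fun i => Q x r i) (iota 0 (f x r))).
Proof.
move=> Hf HQ.
have := dfn_leq (dfn_const 1) (dfn_sum (g := fun x r i => nat_of_bool (Q x r i)) Hf HQ).
apply: dfn_ext => x r; elim: (iota _ _) => [|i s IH]; first by rewrite big_nil.
by rewrite big_cons /=; case: (Q x r i).
Qed.

Lemma dfn_all f (Q : seq A -> env -> nat -> bool) : dfn B f ->
  dfnb B (fun x r => Q x (tail r) (r 0)) ->
  dfnb B (fun x r => all (fun i => Q x r i) (iota 0 (f x r))).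
Proof.
move=> Hf HQ.
have := dfn_not (dfn_has (Q := fun x r i => ~~ Q x r i) Hf (dfn_not HQ)).
by apply: dfn_ext => x r; rewrite has_predC negbK.
Qed.

Lemma dfn_exists (T : finType) (Q : T -> seq A -> env -> bool) :
  (forall z, dfnb B (Q z)) -> dfnb B (fun x r => [exists z, Q z x r]).
Proof.
move=> H; suff : dfnb B (fun x r => has (fun z => Q z x r) (enum T)).
  apply: dfn_ext => x r; congr nat_of_bool; apply/hasP/existsP => [[z _ Hz]|[z Hz]].
    by exists z.
  by exists z; rewrite ?mem_enum.
elim: (enum T) => [|z s IH]; first exact: (dfn_const 0).
exact: (dfn_or (H z) IH).
Qed.

Lemma dfn_forall (T : finType) (Q : T -> seq A -> env -> bool) :
  (forall z, dfnb B (Q z)) -> dfnb B (fun x r => [forall z, Q z x r]).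
Proof.
move=> H; have := dfn_not (dfn_exists (fun z => dfn_not (H z))).
by apply: dfn_ext => x r; rewrite negb_exists; congr nat_of_bool;
  apply: eq_forallb => z; rewrite negbK.
Qed.

(** Variables are bound only by sums: in the sum over [i <= f x r] the factor [i == f x r] leaves
    the single term [F x r (f x r)]. This yields substitution. *)
Lemma dfn_let (F : seq A -> env -> nat -> nat) f :
  dfn B (fun x r => F x (tail r) (r 0)) -> dfn B f ->
  dfn B (fun x r => F x r (f x r)).
Proof.
move=> HF Hf; have Hi := dfn_var A B 0.
have := dfn_sum (g := fun x r i => (i == f x r) * F x r i) (dfn_succ Hf)
  (dfn_mul (dfn_eq Hi (dfn_tail Hf)) HF).
apply: dfn_ext => x r.
have h : f x r \in iota 0 (f x r).+1 by rewrite mem_iota leqnn.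
rewrite (bigD1_seq _ h) ?iota_uniq //= eqxx mul1n big1 ?addn0 // => i.
by move=> /negPf ->.
Qed.

Lemma dfn_app1 (F : seq A -> nat -> nat) f :
  dfn B (fun x r => F x (r 0)) -> dfn B f -> dfn B (fun x r => F x (f x r)).
Proof. exact: (dfn_let (F := fun x _ => F x)). Qed.

Lemma dfn_app2 (F : seq A -> nat -> nat -> nat) f g :
  dfn B (fun x r => F x (r 0) (r 1)) -> dfn B f -> dfn B g ->
  dfn B (fun x r => F x (f x r) (g x r)).
Proof.
move=> HF Hf Hg.
apply: (dfn_let (F := fun x r i => F x (f x r) i)) => //.
by apply: (dfn_let (F := fun x r i => F x i (r 0))) => //; apply: dfn_tail.
Qed.

Lemma dfn_app4 (F : seq A -> nat -> nat -> nat -> nat -> nat) f1 f2 f3 f4 :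
  dfn B (fun x r => F x (r 0) (r 1) (r 2) (r 3)) ->
  dfn B f1 -> dfn B f2 -> dfn B f3 -> dfn B f4 ->
  dfn B (fun x r => F x (f1 x r) (f2 x r) (f3 x r) (f4 x r)).
Proof.
move=> HF H1 H2 H3 H4; have t f := @dfn_tail A B f.
apply: (dfn_let (F := fun x r i => F x (f1 x r) (f2 x r) (f3 x r) i)) => //.
apply: (dfn_let (F := fun x r i => F x (f1 x (tail r)) (f2 x (tail r)) i (r 0)));
  last exact: t _ H3.
apply: (dfn_let (F := fun x r i => F x (f1 x (tail (tail r))) i (r 0) (r 1)));
  last exact: t _ (t _ H2).
apply: (dfn_let (F := fun x r i => F x i (r 0) (r 1) (r 2))) => //.
exact: t _ (t _ (t _ H1)).
Qed.

Lemma dfn_onth (P : pred A) f : dfn B f ->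
  dfnb B (fun x r => oapp P false (onth x (f x r))).
Proof.
move=> Hf; have Hi := dfn_var A B 0.
have := dfn_sum_input P (g := fun x r i => nat_of_bool (i == f x r))
  (dfn_eq Hi (dfn_tail Hf)).
apply: dfn_ext => x r; case: (ltnP (f x r) (size x)) => lt; last first.
  rewrite onth_default // big_seq big1 // => i; rewrite mem_iota /= add0n => ix.
  rewrite (_ : i == f x r = false) ?muln0 //.
  by apply/negbTE; rewrite neq_ltn (leq_trans ix).
have h : f x r \in iota 0 (size x) by rewrite mem_iota.
rewrite (bigD1_seq _ h) ?iota_uniq //= eqxx muln1 big1 ?addn0 // => i.
by move=> /negPf ->; rewrite muln0.
Qed.

Lemma dfn_size : dfn B (fun (x : seq A) _ => size x).
Proof.
have := dfn_sum_input predT (g := fun _ _ _ => 1) (dfn_const 1).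
apply: dfn_ext => x _.
transitivity (\sum_(i <- iota 0 (size x)) 1); last by rewrite sum1_size size_iota.
apply: eq_big_seq => i; rewrite mem_iota /= add0n => ix.
by rewrite muln1 onthE; case: (x) ix => // a s ix; rewrite (nth_map a).
Qed.

(** The quotient counts the positive multiples of [g x r] up to [f x r]; the factor [0 < g x r]
    reproduces the convention that dividing by 0 gives 0. *)
Lemma dfn_div f g : dfn B f -> dfn B g -> dfn B (fun x r => f x r %/ g x r).
Proof.
move=> Hf Hg; have Hi := dfn_var A B 0.
have H1 := dfn_mul (dfn_succ Hi) (dfn_tail Hg).
have := dfn_sum (g := fun x r i => (i.+1 * g x r <= f x r) * (0 < g x r)) Hf
 (dfn_mul (dfn_leq H1 (dfn_tail Hf)) (dfn_leq (dfn_const 1) (dfn_tail Hg))).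
apply: dfn_ext => x r; case: (posnP (g x r)) => [->|g0].
  by rewrite divn0 big1 // => i _; rewrite muln0.
transitivity (\sum_(i <- iota 0 (f x r)) (i < f x r %/ g x r)).
  by apply: eq_bigr => i _; rewrite muln1 leq_divRL.
have := leq_div (f x r) (g x r).
move: (f x r %/ g x r) => k; move: (f x r) => n kn.
rewrite -(subnKC kn) iotaD add0n big_cat /= -[RHS]addn0; congr (_ + _).
  transitivity (\sum_(i <- iota 0 k) 1); last by rewrite sum1_size size_iota.
  apply: eq_big_seq => i.
  by rewrite mem_iota /= add0n => ->.
by rewrite big_seq big1 // => i; rewrite mem_iota => /andP[ki _]; rewrite ltnNge ki.
Qed.

Lemma dfn_mod f g : dfn B f -> dfn B g -> dfn B (fun x r => f x r %% g x r).
Proof.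
move=> Hf Hg; apply: dfn_ext (dfn_sub Hf (dfn_mul (dfn_div Hf Hg) Hg)) => x r.
by rewrite {1}(divn_eq (f x r) (g x r)) addKn.
Qed.

End Closure.

(** * Words of graphs *)

Definition word (p n : nat) (e : nat -> nat -> bool) : seq (option bool) :=
  field_word (binary p) ++
  flatten [seq field_word (mkseq (e u) n) | u <- iota 0 n].

(** Vertices become the numbers below [n] and sets become Boolean predicates, so that the conditions
    on a cover turn into bounded formulas. *)
Definition mcover n (e : nat -> nat -> bool) p : Prop :=
  exists W : nat -> nat -> bool,
  [/\ forall u, u < n -> exists2 i, i < p & W i u,
      forall i u v w, i < p -> u < n -> v < n -> w < n -> e u v -> e v w ->
        u != w -> W i u -> W i w -> W i v &
      forall i, i < p -> exists2 u, u < n & ~~ W i u].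

Definition msplit n (e : nat -> nat -> bool) : Prop :=
  exists K : nat -> bool, forall u v, u < n -> v < n ->
    (K u -> K v -> u != v -> e u v) /\ (~~ K u -> ~~ K v -> ~~ e u v).

Definition mgraph n (e : nat -> nat -> bool) : Prop :=
  (forall u v, u < n -> v < n -> e u v = e v u) /\ (forall u, u < n -> ~~ e u u).

Definition represents (G : sgraph) n (e : nat -> nat -> bool) : Prop :=
  exists phi : 'I_n -> vertex G, bijective phi /\
    forall i j : 'I_n, edge (phi i) (phi j) = e i j.

Lemma represents_cover G n e p : represents G n e ->
  has_P3_convex_cover G p <-> mcover n e p.
Proof.
case=> phi [[psi phiK psiK] Ee]; split.
  case=> V [cV /setP coV].
  pose W (i u : nat) := [exists j : 'I_p, [exists w : 'I_n,
    [&& i == j :> nat, u == w :> nat & phi w \in V j]]].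
  have WP i u (ip : i < p) (un : u < n) :
      W i u = (phi (Ordinal un) \in V (Ordinal ip)).
    apply/existsP/idP => [[j /existsP[w /and3P[/eqP ei /eqP eu]]]|H].
      have -> : Ordinal ip = j by exact: val_inj.
    by have -> : Ordinal un = w by exact: val_inj.
    by exists (Ordinal ip); apply/existsP; exists (Ordinal un); rewrite /= !eqxx.
  exists W; split.
  - move=> u un; have := coV (phi (Ordinal un)); rewrite inE => /bigcupP[i _ Hi].
    exists i => //; rewrite (WP _ _ (ltn_ord i) un).
    by have -> : Ordinal (ltn_ord i) = i by exact: val_inj.
  - move=> i u v w ip un vn wn; rewrite !WP => euv evw uw.
    apply: (cV (Ordinal ip)).1; rewrite ?Ee //.
    by rewrite (bij_eq (Bijective phiK psiK)).
  - move=> i ip; have [_] := cV (Ordinal ip); rewrite eqEsubset subsetT /=.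
    case/subsetPn => x _ Hx; exists (psi x) => //.
    rewrite (WP _ _ ip (ltn_ord _)).
    by have -> : Ordinal (ltn_ord (psi x)) = psi x; [exact: val_inj | rewrite psiK].
case=> W [H1 H2 H3].
exists (fun i => [set x | W i (psi x)]); split; last first.
  apply/setP => x; rewrite [RHS]inE; apply/bigcupP.
  have [i ip Wi] := H1 (psi x) (ltn_ord _).
  by exists (Ordinal ip); rewrite ?inE.
move=> i; split.
  move=> u v w euv evw uw; rewrite !inE.
  apply: H2; rewrite -?Ee ?psiK //.
  apply: contra uw => /eqP/val_inj/(congr1 phi); by rewrite !psiK => ->.
have [u un Wu] := H3 i (ltn_ord i).
apply/eqP => /setP/(_ (phi (Ordinal un))).
by rewrite !inE phiK /= (negPf Wu).
Qed.

Lemma represents_split G n e : represents G n e -> is_split G <-> msplit n e.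
Proof.
case=> phi [[psi phiK psiK] Ee]; split.
  case=> K [H1 H2]; exists (fun u => [exists w : 'I_n, (u == w :> nat) && (phi w \in K)]).
  have KP u (un : u < n) :
      [exists w : 'I_n, (u == w :> nat) && (phi w \in K)] = (phi (Ordinal un) \in K).
    apply/existsP/idP => [[w /andP[/eqP eu]]|H].
      by have -> : Ordinal un = w by exact: val_inj.
    by exists (Ordinal un); rewrite /= eqxx.
  move=> u v un vn; rewrite !KP -[e u v](Ee (Ordinal un) (Ordinal vn)).
  split=> [uK vK uv|]; last exact: H2.
  by apply: H1 => //; rewrite (bij_eq (Bijective phiK psiK)).
case=> K HK; exists [set x | K (psi x)]; split=> u v; rewrite !inE => uK vK.
  have [H _ uv] := HK (psi u) (psi v) (ltn_ord _) (ltn_ord _).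
  rewrite -[u]psiK -[v]psiK Ee; apply: H => //.
  by apply: contra uv => /eqP/val_inj/(congr1 phi); rewrite !psiK => ->.
have [_ H] := HK (psi u) (psi v) (ltn_ord _) (ltn_ord _).
by rewrite -[u]psiK -[v]psiK Ee; apply: H.
Qed.

Lemma encode_word G p : exists n e,
  [/\ represents G n e, mgraph n e & encode G p = word p n e].
Proof.
pose n := #|vertex G|.
pose e i j := if (insub i : option 'I_n, insub j : option 'I_n) is (Some u, Some v)
  then edge (enum_val u) (enum_val v) else false.
have eE (u v : 'I_n) : e u v = edge (enum_val u) (enum_val v) by rewrite /e !valK.
exists n, e; split.
- exists enum_val; split; first exact: enum_val_bij.
  by move=> i j; rewrite eE.
- split=> [u v un vn|u un].
    by rewrite (eE (Ordinal un) (Ordinal vn)) (eE (Ordinal vn) (Ordinal un)) edge_sym.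
  by rewrite (eE (Ordinal un) (Ordinal un)) edge_irrefl.
- have E : enum (vertex G) = map (@enum_val (vertex G) predT) (enum 'I_n).
    have sz : size (enum (vertex G)) = n by rewrite /n cardE.
    case: (posnP n) => [n0|n0].
      by rewrite (size0nil (etrans sz n0)) [enum 'I_n]size0nil ?size_enum_ord.
    have x0 : vertex G := enum_val (Ordinal n0).
    rewrite -{1}(mkseq_nth x0 (enum (vertex G))) sz /mkseq -val_enum_ord -map_comp.
    by apply: eq_map => i; rewrite /= -enum_val_nth.
  rewrite /encode /word; congr (_ ++ flatten _).
  rewrite E -[iota 0 n]val_enum_ord -!map_comp; apply: eq_map => u.
  rewrite /comp; congr field_word; rewrite -map_comp /mkseq -val_enum_ord -map_comp.
  by rewrite -enumT; apply: eq_map => v; rewrite /= eE.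
Qed.

Lemma word_encode n e : mgraph n e ->
  exists G, represents G n e /\ forall p, encode G p = word p n e.
Proof.
case=> sym irr.
have sym' : symmetric (fun u v : 'I_n => e u v) by move=> u v; apply: sym.
have irr' : irreflexive (fun u v : 'I_n => e u v).
  by move=> u; apply/negbTE/irr.
exists (SGraph sym' irr'); split.
  by exists id; split=> //; exists id.
move=> p; rewrite /encode /word -val_enum_ord -map_comp; congr (_ ++ flatten _).
apply: eq_map => u /=; congr field_word.
by rewrite /mkseq -val_enum_ord -map_comp.
Qed.

(** * Unique decoding *)

Lemma index_field_word s t : index None (field_word s ++ t) = size s.
Proof. by rewrite /field_word cat_rcons; elim: s => //= a s ->. Qed.

Lemma take_field_word s t : take (size s) (field_word s ++ t) = map Some s.
Proof. by rewrite /field_word cat_rcons take_size_cat ?size_map. Qed.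

Lemma field_word_inj s s' t t' :
  field_word s ++ t = field_word s' ++ t' -> s = s' /\ t = t'.
Proof.
move=> E; have e : size s = size s' by rewrite -(index_field_word s t) E index_field_word.
have : map Some s = map Some s' :> seq (option bool).
  by rewrite -(take_field_word s t) E e take_field_word.
move=> /inj_map e'; have {}e' : s = s' by apply: e' => a b [].
split=> //; move/(congr1 (drop (size (field_word s)))): E.
by rewrite -e' !drop_size_cat.
Qed.

Lemma binary_rec n : 0 < n -> binary n = odd n :: binary n./2.
Proof.
move=> n0; rewrite /binary up_log2S // /mkseq /= expn0 divn1; congr cons.
rewrite -[1]addn0 iotaDl -map_comp; apply: eq_map => i /=.
by rewrite add1n expnS divnMA divn2.
Qed.

Lemma binary0 : binary 0 = [::].
Proof. by []. Qed.

Lemma binary_inj : injective binary.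
Proof.
move=> m; elim/ltn_ind: m => m IH n.
case: (posnP m) => [->|m0]; case: (posnP n) => [->|n0] //.
- by rewrite binary0 (binary_rec n0).
- by rewrite binary0 (binary_rec m0).
- rewrite (binary_rec m0) (binary_rec n0) => -[eo eb].
  have eh : m./2 = n./2 by apply: IH eb; lia.
  by rewrite -(odd_double_half m) -(odd_double_half n) eo eh.
Qed.

Lemma last_binary p : last true (binary p).
Proof.
elim/ltn_ind: p => p IH; case: (posnP p) => [->|p0] //.
rewrite binary_rec //=; case: (posnP p./2) => [e|p2]; last first.
  by have := IH p./2; rewrite (binary_rec p2) /=; apply; lia.
by rewrite e binary0 /=; lia.
Qed.

(** The condition forbids leading zeros, and its default [true] admits the empty word, which is the
    expansion of 0. The number is rebuilt by Horner's rule. *)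
Lemma binary_ex s : last true s -> exists p, binary p = s.
Proof.
elim: s => [|b s IH] /=; first by exists 0.
case: s IH => [|c s] IH /= H.
  by exists 1; rewrite binary_rec //= binary0 (H : b = true).
have [p Hp] := IH H; exists (b + p.*2).
have p0 : 0 < p by case: p Hp.
rewrite binary_rec; last by lia.
by rewrite half_bit_double Hp oddD odd_double addbF; case: (b).
Qed.

(** * The letters of a word as a function of their index *)

Lemma field_word_mkseq f n :
  field_word (mkseq f n) = mkseq (fun i => if i == n then None else Some (f i)) n.+1.
Proof.
rewrite /field_word /mkseq iota0S map_rcons -map_comp eqxx; congr rcons.
by apply/eq_in_map => i; rewrite mem_iota /= add0n => /ltn_eqF ->.
Qed.

Lemma flatten_mkseq (T : Type) (g : nat -> nat -> T) m n : 0 < m ->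
  flatten [seq mkseq (g u) m | u <- iota 0 n]
  = mkseq (fun k => g (k %/ m) (k %% m)) (n * m).
Proof.
move=> m0; elim: n => // n IH.
rewrite iota0S map_rcons flatten_rcons IH mulSn addnC /mkseq iotaD map_cat.
congr cat; rewrite -[0 + _]addn0 add0n iotaDl -map_comp.
apply/eq_in_map => i; rewrite mem_iota /= add0n => im.
by rewrite divnMDl // divn_small // addn0 modnMDl modn_small.
Qed.

Definition cell_word n (e : nat -> nat -> bool) k : option bool :=
  if k %% n.+1 == n then None else Some (e (k %/ n.+1) (k %% n.+1)).

Lemma wordE p n e :
  word p n e = field_word (binary p) ++ mkseq (cell_word n e) (n * n.+1).
Proof.
congr cat; rewrite -(@flatten_mkseq _ (fun u v => if v == n then None else Some (e u v))) //.
by congr flatten; apply: eq_map => u; rewrite field_word_mkseq.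
Qed.

Lemma word_mkseq p n e : let l := up_log 2 p.+1 in
  word p n e = mkseq (fun k =>
    if k < l then Some (odd (p %/ 2 ^ k)) else
    if k == l then None else cell_word n e (k - l.+1)) (l.+1 + n * n.+1).
Proof.
rewrite wordE field_word_mkseq /mkseq iotaD map_cat; congr cat.
  apply/eq_in_map => i; rewrite mem_iota /= add0n ltnS leq_eqVlt.
  by case: eqP => [->|_ /= ->]; rewrite ?ltnn.
rewrite -[0 + _]addn0 add0n iotaDl -map_comp; apply: eq_map => i /=.
by rewrite addKn ltnNge ltnW ?leq_addr //= gtn_eqF // leq_addr.
Qed.

Lemma cell_wordE n e u v : u < n -> v < n ->
  cell_word n e (u * n.+1 + v) = Some (e u v) /\ u * n.+1 + v < n * n.+1.
Proof.
move=> un vn; rewrite /cell_word modnMDl divnMDl // modn_small; last by lia.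
by rewrite divn_small ?addn0; last lia; rewrite ltn_eqF //; split=> //; nia.
Qed.

(** The first marker [None] cuts off the digits of [p], and the length [n * n.+1] of the rest
    determines [n]. *)
Lemma word_inj p n e p' n' e' : word p n e = word p' n' e' ->
  [/\ p = p', n = n' & forall u v, u < n -> v < n -> e u v = e' u v].
Proof.
rewrite !wordE => /field_word_inj[/binary_inj -> E].
have en : n = n'.
  have := congr1 size E; rewrite !size_mkseq; nia.
split=> // u v un vn; move: E; rewrite -en => E.
have [c1 lt] := cell_wordE e un vn; have [c2 _] := cell_wordE e' un vn.
have := congr1 (fun s => nth None s (u * n.+1 + v)) E.
by rewrite !nth_mkseq // c1 c2 => -[].
Qed.

Lemma eq_mcover n e e' p : (forall u v, u < n -> v < n -> e u v = e' u v) ->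
  mcover n e p -> mcover n e' p.
Proof.
move=> E [W [H1 H2 H3]]; exists W; split=> // i u v w ip un vn wn.
by rewrite -!E //; apply: H2.
Qed.

Lemma eq_msplit n e e' : (forall u v, u < n -> v < n -> e u v = e' u v) ->
  msplit n e -> msplit n e'.
Proof.
by move=> E [K HK]; exists K => u v un vn; rewrite -E //; apply: HK.
Qed.

Definition cover_language (sp : bool) : language (option bool) :=
  if sp then P3_convex_cover_problem_split else P3_convex_cover_problem.

Lemma cover_languageE sp x : cover_language sp x <->
  exists p n e, [/\ mgraph n e, x = word p n e &
                    [/\ 2 <= p, mcover n e p & sp -> msplit n e]].
Proof.
have -> : cover_language sp x <-> exists G p,
    x = encode G p /\ [/\ 2 <= p, has_P3_convex_cover G p & sp -> is_split G].
  case: sp; split=> -[G [p]].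
  - by case=> -[*]; exists G, p.
  - by case=> -> [? ? H]; exists G, p; split=> //; split=> //; apply: H.
  - by case=> -[*]; exists G, p.
  - by case=> -> [? ? H]; exists G, p.
split=> [[G [p [-> [p2 c s]]]]|[p [n [e [ge -> [p2 c s]]]]]].
  have [n [e [R ge ->]]] := encode_word G p; exists p, n, e; split=> //.
  by split=> // [|/s]; [apply/(represents_cover p R) | move/(represents_split R)].
have [G [R E]] := word_encode ge; exists G, p; split; first by rewrite E.
by split=> // [|/s]; [apply/(represents_cover p R) | move/(represents_split R)].
Qed.

Lemma cover_language_word sp p n e : mgraph n e ->
  cover_language sp (word p n e) <->
  [/\ 2 <= p, mcover n e p & sp -> msplit n e].
Proof.
move=> ge; rewrite cover_languageE; split; last by exists p, n, e.
case=> p' [n' [e' [_ /word_inj[<- <- E] [p2 c s]]]].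
have E' u v : u < n -> v < n -> e' u v = e u v by move=> *; rewrite E.
split=> //; first exact: eq_mcover c.
by move=> /s; apply: eq_msplit.
Qed.

(** * Binary digits by bounded arithmetic *)

Definition pow2 j := (0 < j) &&
  all (fun d => [|| 0 < j %% d, d == 1 | d %% 2 == 0]) (iota 0 j.+1).

(** Raising 2 to a variable exponent is not polynomially bounded, so powers of 2 are recognised
    rather than computed: their divisors other than 1 are even. *)
Lemma pow2P j : reflect (exists i, j = 2 ^ i) (pow2 j).
Proof.
apply: (iffP andP) => [[j0 /allP H]|[i ->]].
  (* The odd part [m] of [j] is a divisor of [j], so it is 1. *)
  have [m co e] := pfactor_coprime (isT : prime 2) j0.
  exists (logn 2 j); rewrite {1}e.
  have jm : j %% m = 0 by rewrite e modnMr.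
  have := H m; rewrite mem_iota add0n jm modn2 ltnn.
  rewrite coprime2n in co; rewrite co /= orbF => H1.
  rewrite (eqP (H1 _)) ?mul1n // ltnS e leq_pmulr // expn_gt0 //.
split; first by rewrite expn_gt0.
apply/allP => d _; case: posnP => //= /eqP dv.
have /(dvdn_pfactor _ _ (isT : prime 2))[[|m] _ ->] : d %| 2 ^ i by [].
  by [].
by rewrite expnS modnMr orbT.
Qed.

(** From [m] to [m.+1], [up_log 2] grows by 1 exactly when [m] is a power of 2. This makes the
    number of binary digits definable. *)
Lemma sum_pow2 m : \sum_(j <- iota 0 m) pow2 j = up_log 2 m.
Proof.
elim: m => [|m IH]; first by rewrite big_nil.
rewrite iota0S big_rcons /= addnC IH; case: (posnP m) => [->|m0] //.
case: pow2P => [[i ->]|np].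
  rewrite up_expnK // add1n; apply/esym/up_log_eq => //.
  by rewrite ltnSn expnS mul2n -addnn -addn1 leq_add2l expn_gt0.
rewrite add0n; case: (ltnP 1 m) => [m1|]; last first.
  by move=> m1; case: np; exists 0; lia.
have := up_log_bounds (isT : 1 < 2) m1; move: (up_log_gt0 2 m); rewrite m1.
case: (up_log 2 m) => // k _ /= /andP[lt le]; apply/esym/up_log_eq => //.
rewrite ltnS (ltnW lt) /= ltn_neqAle le andbT.
by apply/eqP => e; case: np; exists k.+1.
Qed.

(* [2 ^ i], as long as it does not exceed [m]. *)
Definition pow2_upto m i :=
  \sum_(j <- iota 0 m.+1) pow2 j * (up_log 2 j == i) * j.

Lemma pow2_uptoE m i : 2 ^ i <= m -> pow2_upto m i = 2 ^ i.
Proof.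
move=> le; have h : 2 ^ i \in iota 0 m.+1 by rewrite mem_iota ltnS.
rewrite /pow2_upto (bigD1_seq _ h) ?iota_uniq //=.
have -> : pow2 (2 ^ i) by apply/pow2P; exists i.
rewrite up_expnK // eqxx !mul1n big1 ?addn0 // => j ji.
case: pow2P => [[k ek]|]; last by rewrite !mul0n.
rewrite ek up_expnK //; case: (k =P i) => [ki|_]; last by rewrite muln0.
by rewrite ek ki eqxx in ji.
Qed.

Section WordDefinable.
Variables A B : finType.
Implicit Types (f g : seq A -> env -> nat).

Lemma dfn_pow2 f : dfn B f -> dfnb B (fun x r => pow2 (f x r)).
Proof.
apply: (dfn_app1 (F := fun _ j => nat_of_bool (pow2 j))).
have H j := dfn_var A B j; apply: dfn_and; first exact: dfn_leq (dfn_const _ _ 1) (H 0).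
apply: dfn_all; first exact: dfn_succ.
apply: dfn_or; first exact: dfn_leq (dfn_const _ _ 1) (dfn_mod (H 1) (H 0)).
apply: dfn_or; first exact: dfn_eq (dfn_const _ _ 1).
exact: dfn_eq (dfn_mod (H 0) (dfn_const _ _ 2)) (dfn_const _ _ 0).
Qed.

Lemma dfn_up_log2 f : dfn B f -> dfn B (fun x r => up_log 2 (f x r)).
Proof.
move=> Hf; apply: dfn_ext (dfn_sum (g := fun _ _ j => nat_of_bool (pow2 j)) Hf _).
  by move=> x r; rewrite sum_pow2.
exact/dfn_pow2/dfn_var.
Qed.

Lemma dfn_bit f g : dfn B f -> dfn B g ->
  dfnb B (fun x r => odd (f x r %/ pow2_upto (f x r) (g x r))).
Proof.
move=> Hf Hg; have Hi := dfn_var A B 0.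
suff H : dfn B (fun x r => pow2_upto (f x r) (g x r)).
  apply: dfn_ext (dfn_eq (dfn_mod (dfn_div Hf H) (dfn_const _ _ 2)) (dfn_const _ _ 1)).
  by move=> x r; rewrite modn2 eqb1.
apply: (dfn_sum (g := fun x r i => pow2 i * (up_log 2 i == g x r) * i)).
  exact: dfn_succ.
exact: dfn_mul (dfn_mul (dfn_pow2 Hi) (dfn_eq (dfn_up_log2 Hi) (dfn_tail Hg))) Hi.
Qed.

End WordDefinable.

(** For an index [k] of a digit of [p] one has [2 ^ k <= p], so the cut at [p] is harmless. *)
Lemma bitE p k : k < up_log 2 p.+1 -> odd (p %/ pow2_upto p k) = odd (p %/ 2 ^ k).
Proof.
move=> kl; rewrite pow2_uptoE //.
case: p kl => [|p] kl; first by rewrite up_log1 in kl.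
have := up_log_gtn (isT : 1 < 2) (isT : 1 < p.+2); rewrite ltnS.
move=> /(leq_trans _); apply.
by rewrite leq_exp2l //; lia.
Qed.

Definition symbol (s : nat) : option bool :=
  if s is s'.+1 then Some (s' == 1) else None.

Lemma polytime_word (A : finType) (p n : seq A -> nat) (e : seq A -> nat -> nat -> bool) :
  dfn (option bool) (fun x _ => p x) -> dfn (option bool) (fun x _ => n x) ->
  dfnb (option bool) (fun x r => e x (r 0) (r 1)) ->
  polytime (fun x => word (p x) (n x) (e x)).
Proof.
move=> Hp Hn He.
pose l x := up_log 2 (p x).+1.
pose cell x k := if k %% (n x).+1 == n x then 0
  else (nat_of_bool (e x (k %/ (n x).+1) (k %% (n x).+1))).+1.
pose sym x k := if k < l x then (nat_of_bool (odd (p x %/ pow2_upto (p x) k))).+1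
  else if k == l x then 0 else cell x (k - (l x).+1).
have := @polytime_mkseq A _ symbol 2 (fun x => (l x).+1 + n x * (n x).+1) sym.
have E x : word (p x) (n x) (e x) =
    mkseq (fun i => symbol (sym x i)) ((l x).+1 + n x * (n x).+1).
  rewrite word_mkseq; apply/eq_in_map => i _; rewrite /sym -/(l x).
  case: ifP => [lt|_]; first by rewrite bitE //; case: (odd _).
  case: ifP => // _; rewrite /cell_word /cell; case: ifP => // _.
  by case: (e x _ _).
move=> H; suff : polytime
    (fun x => mkseq (fun i => symbol (sym x i)) ((l x).+1 + n x * (n x).+1)).
  case=> G [iA [iB [M [c [d [h1 h2 h3]]]]]].
  by exists G, iA, iB, M, c, d; split=> // x; rewrite E.
have Hl : dfn (option bool) (fun x _ => l x) by apply/dfn_up_log2/dfn_succ.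
apply: H.
- apply: dfn_add; first exact: dfn_succ.
  by apply: dfn_mul => //; apply: dfn_succ.
- have Hi := dfn_var A (option bool) 0.
  apply: dfn_if; first exact: dfn_leq (dfn_succ Hi) Hl.
    by apply: dfn_succ; apply: dfn_bit.
  apply: dfn_if; first exact: dfn_eq.
    exact: dfn_const.
  have Hk := dfn_sub Hi (dfn_succ Hl).
  have Hm := dfn_mod Hk (dfn_succ Hn).
  apply: dfn_if; [exact: dfn_eq | exact: dfn_const | apply: dfn_succ].
  apply: (dfn_app2 (F := fun x u v => nat_of_bool (e x u v))) => //.
  exact: dfn_div (dfn_succ Hn).
- have le2 (b : bool) : b.+1 <= 2 by case: b.
  by move=> x i _; rewrite /sym /cell; do ![case: ifP => _]; rewrite ?le2.
Qed.

(** * Satisfiability reduces to covers of split graphs *)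

(* [lit j i s]: clause [j] contains the literal of variable [i] that is true
   when [i] has value [s].  Variable 0 does not exist. *)
Definition sat B (lit : nat -> nat -> bool -> bool) : Prop :=
  exists a : nat -> bool, forall j, j < B ->
    exists i, [&& 0 < i, i < B & lit j i (a i)].

(* The vertices are [4 i + k] with [i < B]: for [k = 0] the colour [i] (colour 0
   stands for falsity), for [k = 1] and [k = 2] the positive and negative
   literals of variable [i], for [k = 3] the clause [i]. *)
Definition arc (lit : nat -> nat -> bool -> bool) a b : bool :=
  let i := a %/ 4 in let j := b %/ 4 in
  let k := a %% 4 in let l := b %% 4 in
  [|| [&& k == 0, l == 0 & ~~ (i == j)],
      [&& (k == 1) || (k == 2), l == 0, 0 < i, 0 < j & ~~ (i == j)],
      [&& k == 1, l == 2, i == j & 0 < i],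
      [&& k == 3, l == 0 & j == 0] |
      [&& k == 3, (l == 1) || (l == 2), 0 < j &
          if l == 1 then ~~ lit i j true else ~~ lit i j false]].

Definition conflict lit a b := arc lit a b || arc lit b a.

Definition incident B lit k c :=
  (c == k %/ (4 * B)) || (c == k %% (4 * B)) && conflict lit (k %/ (4 * B)) c.

(* The clique consists of the pairs of vertices of the conflict graph, coded as
   numbers below [Q = (4 B)^2], and the independent set of its vertices; a pair
   is adjacent to its first component, and to the second one if the two are in
   conflict. *)
Definition split_edge B lit u v : bool :=
  let Q := 4 * B * (4 * B) in
  if u < Q then if v < Q then ~~ (u == v) else incident B lit u (v - Q)
  else (v < Q) && incident B lit v (u - Q).

Section Reduction.
Variables (B : nat) (lit : nat -> nat -> bool -> bool).
Hypothesis B0 : 0 < B.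
Notation M := (4 * B).
Notation Q := (4 * B * (4 * B)).
Notation N := (Q + M).
Notation e := (split_edge B lit).
Notation H := (conflict lit).

Lemma conflict_irr a : ~~ H a a.
Proof.
by rewrite /conflict orbb /arc !eqxx !andbF /=; case: (a %% 4) => [|[|[|[]]]].
Qed.

Lemma arcE i k j l : k < 4 -> l < 4 -> arc lit (4 * i + k) (4 * j + l) =
  [|| [&& k == 0, l == 0 & ~~ (i == j)],
      [&& (k == 1) || (k == 2), l == 0, 0 < i, 0 < j & ~~ (i == j)],
      [&& k == 1, l == 2, i == j & 0 < i],
      [&& k == 3, l == 0 & j == 0] |
      [&& k == 3, (l == 1) || (l == 2), 0 < j &
          if l == 1 then ~~ lit i j true else ~~ lit i j false]].
Proof.
move=> k4 l4; rewrite /arc mulnC [4 * j]mulnC !modnMDl !divnMDl //.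
by rewrite (divn_small k4) (divn_small l4) !modn_small // !addn0.
Qed.

Lemma split_edge_mgraph n : mgraph n e.
Proof.
split=> [u v _ _|u _]; rewrite /split_edge.
  by case: (ltnP u Q); case: (ltnP v Q); rewrite // eq_sym.
by case: (ltnP u Q); rewrite ?eqxx.
Qed.

Lemma split_edge_msplit : msplit N e.
Proof.
exists (fun u => u < Q) => u v _ _; rewrite /split_edge; split.
  by move=> -> ->.
by move=> /negPf -> /negPf ->.
Qed.

Lemma edgeKK u v : u < Q -> v < Q -> e u v = (u != v).
Proof. by rewrite /split_edge => -> ->. Qed.

Lemma edgeKI u c : u < Q -> e u (Q + c) = incident B lit u c.
Proof. by rewrite /split_edge => ->; rewrite ltnNge leq_addr addKn. Qed.

Lemma edgeIK u c : u < Q -> e (Q + c) u = incident B lit u c.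
Proof. by rewrite /split_edge => ->; rewrite ltnNge leq_addr addKn. Qed.

Lemma pair_lt a b : a < M -> b < M -> a * M + b < Q.
Proof. by move=> aM bM; nia. Qed.

Lemma incident_pair a b c : a < M -> b < M ->
  incident B lit (a * M + b) c = (c == a) || (c == b) && H a c.
Proof.
move=> aM bM; have M0 : 0 < M by lia.
by rewrite /incident divnMDl // modnMDl modn_small // divn_small // addn0.
Qed.

(** * From a cover to a satisfying assignment *)

Section FromCover.
Variable W : nat -> nat -> bool.
Hypothesis cov : forall u, u < N -> exists2 i, i < Q + B & W i u.
Hypothesis convex : forall i u v w, i < Q + B -> u < N -> v < N -> w < N ->
  e u v -> e v w -> u != w -> W i u -> W i w -> W i v.
Hypothesis proper : forall i, i < Q + B -> exists2 u, u < N & ~~ W i u.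

Let clN u : u < Q -> u < N. Proof. by move=> uQ; rewrite ltn_addr. Qed.

Let N_I a : a < M -> Q + a < N. Proof. by rewrite ltn_add2l. Qed.

(** Two clique vertices generate the whole graph: any other clique vertex is the middle of a path
    between them, and then each [a] of the independent set lies between its neighbours [(a, 0)] and
    [(a, 1)]. *)
Lemma one_clique_vertex i u v : i < Q + B -> u < Q -> v < Q ->
  W i u -> W i v -> u = v.
Proof.
move=> iB uQ vQ Wu Wv; apply/eqP/negPn/negP => uv.
have WK w : w < Q -> W i w.
  move=> wQ; case: (w =P u) => [->//|/eqP wu]; case: (w =P v) => [->//|/eqP wv].
  by apply: (convex iB (clN uQ) (clN wQ) (clN vQ)) => //; rewrite edgeKK // eq_sym.
have [w wN] := proper iB; case: (ltnP w Q) => [wQ|Qw]; first by rewrite WK.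
pose a := w - Q; have aM : a < M by rewrite /a; lia.
have -> : w = Q + a by rewrite /a subnKC.
have [M0 M1] : 0 < M /\ 1 < M by lia.
have [p0 p1] := (pair_lt aM M0, pair_lt aM M1).
apply/negP/negPn; apply: (convex iB (clN p0) (N_I aM) (clN p1)); rewrite ?WK //.
- by rewrite edgeKI // incident_pair // eqxx.
- by rewrite edgeIK // incident_pair // eqxx.
- by rewrite eqn_add2l.
Qed.

Lemma clique_or_independent i u a : i < Q + B -> u < Q -> a < M ->
  W i u -> ~~ W i (Q + a).
Proof.
move=> iB uQ aM Wu; apply/negP => Wa.
(* One of the neighbours [(a, 0)] and [(a, 1)] of [a] differs from [u]; being the middle of a path
   from [u] to [a], it would be a second clique vertex of the set. *)
have [b [bM nb]] : exists b, b < M /\ a * M + b != u.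
  case: (a * M + 0 =P u) => [<-|/eqP ne]; last by exists 0; split=> //; lia.
  by exists 1; rewrite eqn_add2l; split=> //; lia.
have bQ := pair_lt aM bM.
suff Wb : W i (a * M + b) by rewrite (one_clique_vertex iB bQ uQ Wb Wu) eqxx in nb.
apply: (convex iB (clN uQ) (clN bQ) (N_I aM)) => //.
- by rewrite edgeKK // eq_sym.
- by rewrite edgeKI // incident_pair // eqxx.
- by apply/eqP => E; move: uQ; rewrite E ltnNge leq_addr.
Qed.

(** The clique vertex [(a, b)] is adjacent to both [a] and [b], so convexity would put it into the
    set beside them. *)
Lemma independent_proper i a b : i < Q + B -> a < M -> b < M -> H a b ->
  W i (Q + a) -> ~~ W i (Q + b).
Proof.
move=> iB aM bM ab Wa; apply/negP => Wb.
have nab : a != b by apply: contraTneq ab => ->; apply: conflict_irr.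
have pQ := pair_lt aM bM; suff Wp : W i (a * M + b).
  by have := clique_or_independent iB pQ aM Wp; rewrite Wa.
apply: (convex iB (N_I aM) (clN pQ) (N_I bM)); rewrite // ?eqn_add2l //.
- by rewrite edgeIK // incident_pair // eqxx.
- by rewrite edgeKI // incident_pair // eqxx ab orbT.
Qed.

Let col u : nat := find (fun i => W i u) (iota 0 (Q + B)).

Let colP u : u < N -> col u < Q + B /\ W (col u) u.
Proof.
move=> uN; have [i iB Wi] := cov uN.
have h : has (fun i => W i u) (iota 0 (Q + B)).
  by apply/hasP; exists i; rewrite ?mem_iota.
have lt : col u < Q + B by move: h; rewrite has_find size_iota.
by split=> //; have := nth_find 0 h; rewrite nth_iota.
Qed.

Let c a := col (Q + a).

Let cP a b : a < M -> b < M -> H a b -> c a <> c b.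
Proof.
move=> aM bM ab E; have [iB Wa] := colP (N_I aM); have [_ Wb] := colP (N_I bM).
by have := independent_proper iB aM bM ab Wa; rewrite [col _]E Wb.
Qed.

(** The sets chosen for the [Q] clique vertices and the [B] colours are pairwise different, so they
    are all the [Q + B] sets. The one chosen for [a] is among them, and it is not that of a clique
    vertex. *)
Lemma color_of_clique a : a < M -> exists2 i, i < B & c a = c (4 * i).
Proof.
move=> aM; pose w (z : 'I_Q + 'I_B) : nat :=
  match z with inl u => u | inr i => Q + 4 * i end.
have wM (i : 'I_B) : 4 * i < M by rewrite ltn_mul2l ltn_ord.
have wN z : w z < N by case: z => [u|i]; [exact/clN/ltn_ord | exact/N_I/wM].
pose f z : 'I_(Q + B) := Ordinal (colP (wN z)).1.
have f_inj : injective f.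
  move=> z z' /(congr1 val) /= E; move: (colP (wN z)) (colP (wN z')).
  rewrite -E => -[lt Wz] [_ Wz']; case: z z' E Wz Wz' {lt} => [u|i] [u'|i'] /= E Wz Wz'.
  - congr inl; apply: val_inj => /=.
    exact: one_clique_vertex (colP (clN (ltn_ord u))).1 _ _ Wz Wz'.
  - have := clique_or_independent (colP (clN (ltn_ord u))).1 (ltn_ord u) (wM i') Wz.
    by rewrite Wz'.
  - have := clique_or_independent (colP (N_I (wM i))).1 (ltn_ord u') (wM i) Wz'.
    by rewrite Wz.
  - congr inr; apply/val_inj/eqP/negPn/negP => /= ii'.
    case: (cP (wM i) (wM i') _ E).
    by rewrite /conflict -[4 * i]addn0 -[4 * i']addn0 !arcE //= ii'.
have card_le : #|'I_(Q + B)| <= #|{: 'I_Q + 'I_B}| by rewrite card_sum !card_ord.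
have [lt Wa] := colP (N_I aM).
have /codomP[[u|i] E] := inj_card_onto f_inj card_le (Ordinal lt).
  have [_] := colP (clN (ltn_ord u)); have /= <- := congr1 val E => Wu.
  by have := clique_or_independent lt (ltn_ord u) aM Wu; rewrite Wa.
by exists i => //; apply: (congr1 val E).
Qed.

(** For [i > 0], the two literals of variable [i] conflict with each other and with all colours
    except 0 and [i]; so one has colour [i] and counts as true, the other has colour 0. A clause
    conflicts with colour 0 and with the literals outside it; if its colour is [i], then it contains
    the literal of colour [i]. *)
Lemma sat_of_cover : sat B lit.
Proof.
have V i : i < B -> 4 * i + 0 < M by lia.
have X i : i < B -> 4 * i + 1 < M by lia.
have Y i : i < B -> 4 * i + 2 < M by lia.
have C i : i < B -> 4 * i + 3 < M by lia.
have colE a : a < M -> exists2 i, i < B & c a = c (4 * i + 0).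
  by move=> /color_of_clique[i iB E]; exists i; rewrite ?addn0.
exists (fun i => c (4 * i + 1) == c (4 * i + 0)) => j jB.
have [i iB Ei] := colE _ (C j jB).
have i0 : 0 < i.
  rewrite lt0n; apply/eqP => e; rewrite e in Ei iB.
  by apply: cP Ei; rewrite ?C ?V // /conflict !arcE.
exists i; rewrite i0 iB /=; case: eqP => [E|/eqP E].
  apply/negPn/negP => nl; apply: (cP (C j jB) (X i iB)); last by rewrite Ei E.
  by rewrite /conflict !arcE //= i0 nl.
apply/negPn/negP => nl; have [k kB Ek] := colE _ (X i iB).
have k0 : k = 0.
  apply/eqP/negPn/negP => k0; case: (i =P k) => [ik|/eqP ik].
    by rewrite Ek ik eqxx in E.
  by apply: (cP (X i iB) (V k kB)) Ek; rewrite /conflict !arcE //= i0 lt0n k0 ik.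
have [l lB El] := colE _ (Y i iB).
have il : i = l.
  apply/eqP/negPn/negP => il; case: (posnP l) => [l0|l0].
    apply: (cP (X i iB) (Y i iB)); last by rewrite Ek El k0 l0.
    by rewrite /conflict !arcE //= i0 eqxx.
  by apply: (cP (Y i iB) (V l lB)) El; rewrite /conflict !arcE //= i0 l0 il.
apply: (cP (C j jB) (Y i iB)); last by rewrite Ei El il.
by rewrite /conflict !arcE //= i0 nl.
Qed.

End FromCover.

(** * From a satisfying assignment to a cover *)

Section ToCover.
Variable a : nat -> bool.
Hypothesis Ha : forall j, j < B -> exists i, [&& 0 < i, i < B & lit j i (a i)].

Let witness j := find (fun i => (0 < i) && lit j i (a i)) (iota 0 B).

Let witnessP j : j < B -> [&& 0 < witness j, witness j < B & lit j (witness j) (a (witness j))].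
Proof.
move=> /Ha[i /and3P[i0 iB li]].
have h : has (fun i => (0 < i) && lit j i (a i)) (iota 0 B).
  by apply/hasP; exists i; rewrite ?mem_iota ?i0.
have lt : witness j < B by move: h; rewrite has_find size_iota.
by have := nth_find 0 h; rewrite nth_iota // add0n lt /= => /andP[-> ->].
Qed.

Let color v : nat :=
  let i := v %/ 4 in
  match v %% 4 with
  | 0 => i
  | 1 => if (0 < i) && a i then i else 0
  | 2 => if (0 < i) && ~~ a i then i else 0
  | _ => witness i
  end.

Let color_lt v : v < M -> color v < B.
Proof.
move=> vM; have iB : v %/ 4 < B by rewrite ltn_divLR // mulnC.
rewrite /color; case: (v %% 4) => [|[|[|k]]] //; do ?case: ifP => //.
by have /and3P[] := witnessP iB.
Qed.

Let color_arc u v : u < M -> v < M -> arc lit u v -> color u <> color v.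
Proof.
move=> uM vM; have uB : u %/ 4 < B by rewrite ltn_divLR // mulnC.
have vB : v %/ 4 < B by rewrite ltn_divLR // mulnC.
have := witnessP uB; rewrite /arc /color.
move: (u %/ 4) (v %/ 4) uB vB => i j iB jB /and3P[w0 wB wl].
case: (u %% 4) => [|[|[|[|k]]]]; case: (v %% 4) => [|[|[|[|l]]]] //=; rewrite ?orbF ?andbF //.
- by move=> /eqP.
- move=> /and3P[_ j0 /eqP ij]; case: ifP => _ //.
  by move=> e0; rewrite -e0 in j0.
- case/andP => /eqP <- i0; rewrite i0 /=; case: (a i) => /= e0.
    by rewrite e0 in i0.
  by rewrite -e0 in i0.
- move=> /and3P[_ j0 /eqP ij]; case: ifP => _ //.
  by move=> e0; rewrite -e0 in j0.
- by move=> /eqP -> e0; rewrite e0 in w0.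
- move=> /andP[j0 nl]; rewrite j0 /=; case: ifP => aj e0.
    by rewrite e0 aj (negPf nl) in wl.
  by rewrite e0 in w0.
- move=> /andP[j0 nl]; rewrite j0 /=; case: ifP => aj e0.
    by rewrite e0 (negPf aj) (negPf nl) in wl.
  by rewrite e0 in w0.
Qed.

Let color_conflict u v : u < M -> v < M -> H u v -> color u <> color v.
Proof.
move=> uM vM /orP[uv|vu]; first exact: color_arc.
by move/esym; apply: color_arc.
Qed.

Lemma cover_of_sat : mcover N e (Q + B).
Proof.
exists (fun i u => if i < Q then u == i else (Q <= u) && (color (u - Q) == i - Q)).
have Q0 : 1 < Q by nia.
split.
- move=> u uN; case: (ltnP u Q) => [uQ|Qu].
    by exists u; rewrite ?uQ ?eqxx // ltn_addr.
  have uM : u - Q < M by lia.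
  exists (Q + color (u - Q)); first by rewrite ltn_add2l color_lt.
  by rewrite [_ + _ < _]ltnNge leq_addr addKn eqxx.
- move=> i u v w iB uN vN wN euv evw uw; case: ifP => _.
    by move=> /eqP ui /eqP wi; rewrite ui wi eqxx in uw.
  move=> /andP[Qu /eqP cu] /andP[Qw /eqP cw].
  pose u' := u - Q; pose w' := w - Q.
  have [uM wM] : u' < M /\ w' < M by rewrite /u' /w'; lia.
  have [eu ew] : u = Q + u' /\ w = Q + w' by rewrite !subnKC.
  case: (ltnP v Q) => vQ; last first.
    by move: euv; rewrite /split_edge !ltnNge Qu vQ.
  (* The middle vertex [v] is a pair. It has two distinct neighbours in the independent set only if
     these are its components and are in conflict, which their equal colours exclude. *)
  move: euv evw uw; rewrite eu ew edgeIK // edgeKI // eqn_add2l /incident.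
  have nc b c : b < M -> c < M -> color b = color c -> H b c -> False.
    by move=> bM cM ec bc; apply: (color_conflict bM cM bc).
  have cc : color u' = color w' by rewrite cu cw.
  case: (u' =P v %/ M) => [<-|_] /=; case: (w' =P _) => [<-|_] /=.
  + by rewrite eqxx.
  + by move=> _ /andP[_ h]; case: (nc _ _ uM wM cc h).
  + by move=> /andP[_ h]; case: (nc _ _ wM uM (esym cc) h).
  + by move=> /andP[/eqP-> _] /andP[/eqP-> _]; rewrite eqxx.
- move=> i iB; case: (ltnP i Q) => iQ; last first.
    by exists 0; [rewrite ltn_addr // ltnW | rewrite leqNgt (ltnW Q0)].
  case: (posnP i) => [->|i0]; first by exists 1; rewrite // ltn_addr.
  by exists 0; [rewrite ltn_addr // ltnW | rewrite eq_sym -lt0n].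
Qed.

End ToCover.

Lemma sat_cover_language sp :
  cover_language sp (word (Q + B) N e) <-> sat B lit.
Proof.
rewrite (cover_language_word _ _ (split_edge_mgraph N)); split.
  by case=> _ [W [H1 H2 H3]] _; apply: (sat_of_cover H1 H2 H3).
case=> a Ha; split; [by nia | exact: (cover_of_sat Ha) | by move=> _; exact: split_edge_msplit].
Qed.

End Reduction.

(** * Computability of the reduction *)

Section SatDefinable.
Variable A : finType.
Variables (B : seq A -> nat) (lit : seq A -> nat -> nat -> bool -> bool).
Notation C := (option bool).
Hypothesis dB : dfn C (fun x _ => B x).
Hypothesis dlit : forall s, dfnb C (fun x r => lit x (r 0) (r 1) s).

Let Hc n := dfn_const A C n.

Lemma dfn_lit s f g : dfn C f -> dfn C g ->
  dfnb C (fun x r => lit x (f x r) (g x r) s).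
Proof. exact: (dfn_app2 (F := fun x j i => nat_of_bool (lit x j i s))). Qed.

Lemma dfn_conflict f g : dfn C f -> dfn C g ->
  dfnb C (fun x r => conflict (lit x) (f x r) (g x r)).
Proof.
have H f' g' : dfn C f' -> dfn C g' -> dfnb C (fun x r => arc (lit x) (f' x r) (g' x r)).
  move=> Hf Hg; have Hi := dfn_div Hf (Hc 4); have Hj := dfn_div Hg (Hc 4).
  have Hk := dfn_mod Hf (Hc 4); have Hl := dfn_mod Hg (Hc 4).
  have k_ n := dfn_eq Hk (Hc n); have l_ n := dfn_eq Hl (Hc n).
  have ij := dfn_eq Hi Hj.
  have i0 := dfn_leq (Hc 1) Hi; have j0 := dfn_leq (Hc 1) Hj.
  apply: dfn_or; first exact: dfn_and (k_ 0) (dfn_and (l_ 0) (dfn_not ij)).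
  apply: dfn_or.
    exact: dfn_and (dfn_or (k_ 1) (k_ 2))
      (dfn_and (l_ 0) (dfn_and i0 (dfn_and j0 (dfn_not ij)))).
  apply: dfn_or; first exact: dfn_and (k_ 1) (dfn_and (l_ 2) (dfn_and ij i0)).
  apply: dfn_or; first exact: dfn_and (k_ 3) (dfn_and (l_ 0) (dfn_eq Hj (Hc 0))).
  apply: dfn_and (k_ 3) (dfn_and (dfn_or (l_ 1) (l_ 2)) (dfn_and j0 _)).
  by apply: dfn_ifb (l_ 1) _ _; apply/dfn_not/dfn_lit.
by move=> Hf Hg; apply: dfn_or; apply: H.
Qed.

Lemma dfn_split_edge f g : dfn C f -> dfn C g ->
  dfnb C (fun x r => split_edge (B x) (lit x) (f x r) (g x r)).
Proof.
have HM := dfn_mul (Hc 4) dB; have HQ := dfn_mul HM HM.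
have H f' g' : dfn C f' -> dfn C g' ->
    dfnb C (fun x r => incident (B x) (lit x) (f' x r) (g' x r)).
  move=> Hf Hg; have Hd := dfn_div Hf HM.
  apply: dfn_or; first exact: dfn_eq Hg Hd.
  exact: dfn_and (dfn_eq Hg (dfn_mod Hf HM)) (dfn_conflict Hd Hg).
move=> Hf Hg; have uQ := dfn_leq (dfn_succ Hf) HQ.
have vQ := dfn_leq (dfn_succ Hg) HQ.
apply: dfn_ifb uQ _ _; last exact: dfn_and vQ (H _ _ Hg (dfn_sub Hf HQ)).
apply: dfn_ifb vQ (dfn_not (dfn_eq Hf Hg)) (H _ _ Hf (dfn_sub Hg HQ)).
Qed.

Lemma sat_reduces (L : language A) sp : (forall x, 0 < B x) ->
  (forall x, L x <-> sat (B x) (lit x)) -> poly_reduces L (cover_language sp).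
Proof.
move=> B0 HL; have HM := dfn_mul (Hc 4) dB; have HQ := dfn_mul HM HM.
exists (fun x => word (4 * B x * (4 * B x) + B x) (4 * B x * (4 * B x) + 4 * B x)
  (split_edge (B x) (lit x))); split.
  apply: polytime_word; [exact: dfn_add HQ dB | exact: dfn_add HQ HM |].
  by apply: dfn_split_edge; apply: dfn_var.
by move=> x; rewrite HL (sat_cover_language _ (B0 x)).
Qed.

End SatDefinable.

Ltac dfn_step := match goal with
  | |- forall x, _ => intro
  | |- dfn _ (fun _ _ => ?c) => exact: dfn_const
  | |- dfn _ (fun _ r => r ?j) => exact: dfn_var
  | H : dfn _ _ |- _ => exact: H
  | H : forall _, dfn _ _ |- _ => exact: H
  | |- dfn _ (fun x r => nat_of_bool (@?a x r && @?b x r)) =>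
      refine (dfn_and (P := a) (Q := b) _ _)
  | |- dfn _ (fun x r => nat_of_bool (@?a x r || @?b x r)) =>
      refine (dfn_or (P := a) (Q := b) _ _)
  | |- dfn _ (fun x r => nat_of_bool (@?a x r ==> @?b x r)) =>
      refine (dfn_imply (P := a) (Q := b) _ _)
  | |- dfn _ (fun x r => nat_of_bool (~~ FiniteQuant.quant0b (@?q x r))) =>
      apply: dfn_exists
  | |- dfn _ (fun x r => nat_of_bool (FiniteQuant.quant0b (@?q x r))) =>
      apply: dfn_forall
  | |- dfn _ (fun x r => nat_of_bool (~~ @?a x r)) =>
      refine (dfn_not (P := a) _)
  | |- dfn _ (fun x r => nat_of_bool (@?a x r <= @?b x r)) =>
      refine (dfn_leq (f := a) (g := b) _ _)
  | |- dfn _ (fun x r => nat_of_bool (@?a x r == @?b x r)) =>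
      first [refine (dfn_eq (f := a) (g := b) _ _)
            |refine (dfn_eqb (P := a) (Q := b) _ _)]
  | |- dfn _ (fun x r => nat_of_bool (has (fun i => @?q x r i) (iota 0 (@?n x r)))) =>
      refine (dfn_has (f := n) (Q := q) _ _)
  | |- dfn _ (fun x r => nat_of_bool (all (fun i => @?q x r i) (iota 0 (@?n x r)))) =>
      refine (dfn_all (f := n) (Q := q) _ _)
  | |- dfn _ (fun x r => (@?a x r).+1) => refine (dfn_succ (f := a) _)
  | |- dfn _ (fun x r => @?a x r + @?b x r) => refine (dfn_add (f := a) (g := b) _ _)
  | |- dfn _ (fun x r => @?a x r - @?b x r) => refine (dfn_sub (f := a) (g := b) _ _)
  | |- dfn _ (fun x r => @?a x r * @?b x r) => refine (dfn_mul (f := a) (g := b) _ _)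
  | |- dfn _ (fun x r => @?a x r %/ @?b x r) => refine (dfn_div (f := a) (g := b) _ _)
  | |- dfn _ (fun x r => @?a x r %% @?b x r) => refine (dfn_mod (f := a) (g := b) _ _)
  | |- dfn _ (fun x r => @?a x r ^ ?d) => refine (dfn_exp (f := a) d _)
  | |- dfn _ (fun x r => size x) => exact: dfn_size
  | |- dfn _ (fun x r => nat_of_bool (oapp ?P false (onth x (@?a x r)))) =>
      refine (dfn_onth P (f := a) _)
  end.

Ltac dfn_auto := repeat (cbv beta delta [tail]; dfn_step).

(** * Clauses indexed by kinds, times and positions *)

(* A variable is a triple [(z, t, p)].  If [guard xi x t p], then there is a
   clause stating that the variables in [prem xi x t p] imply one of those in
   [conc xi x t p]. *)
Section Clauses.
Variables (A Z Xi : finType) (D : seq A -> nat).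
Variable guard : Xi -> seq A -> nat -> nat -> bool.
Variables prem conc : Xi -> seq A -> nat -> nat -> Z -> nat -> nat -> bool.
Notation C := (option bool).
Hypothesis D0 : forall x, 0 < D x.
Hypothesis dD : dfn C (fun x _ => D x).
Hypothesis dguard : forall xi, dfnb C (fun x r => guard xi x (r 0) (r 1)).
Hypothesis dprem : forall xi z,
  dfnb C (fun x r => prem xi x (r 0) (r 1) z (r 2) (r 3)).
Hypothesis dconc : forall xi z,
  dfnb C (fun x r => conc xi x (r 0) (r 1) z (r 2) (r 3)).

(** Clauses and variables share one numbering because [sat] bounds both by the same number. Kinds
    start at 1, which avoids the missing variable 0, and [K >= 2] guarantees that variable 1 exists
    to satisfy the tautologies. *)
Let K := (maxn #|Z| #|Xi|).+2.
Let code x k t p := k.+1 + K * (t + D x * p).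
Let kind j := j %% K.
Let time x j := (j %/ K) %% D x.
Let pos x j := (j %/ K) %/ D x.

Definition num_clauses x := K * (D x * D x).

(* Variables and clauses are numbered by triples (kind, t, p); the numbers of
   no clause get a tautology. *)
Definition literal x j i (s : bool) : bool :=
  [forall xi : Xi, (kind j == (enum_rank xi).+1) ==>
    (guard xi x (time x j) (pos x j) ==>
     [exists z : Z, (kind i == (enum_rank z).+1) &&
       (if s then conc xi x (time x j) (pos x j) z (time x i) (pos x i)
        else prem xi x (time x j) (pos x j) z (time x i) (pos x i))])].

Let rank_lt (T : finType) (z : T) : #|T| <= maxn #|Z| #|Xi| -> (enum_rank z).+1 < K.
Proof. by move=> le; rewrite /K !ltnS; apply: leq_trans (ltnW (ltn_ord _)) le. Qed.

Let codeP x k t p : k.+1 < K -> t < D x -> p < D x ->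
  let j := code x k t p in
  [/\ kind j = k.+1, time x j = t, pos x j = p & 0 < j < num_clauses x].
Proof.
move=> kK tD pD /=; rewrite /kind /time /pos /code addnC mulnC modnMDl divnMDl //.
rewrite modn_small // divn_small // addn0 addnC mulnC modnMDl divnMDl ?D0 //.
rewrite modn_small // divn_small // addn0; split=> //=.
have le : (p * D x + t).+1 <= D x * D x by nia.
rewrite /num_clauses [K * (D x * _)]mulnC; apply: leq_trans (leq_mul le (leqnn K)).
by rewrite mulSn addnC ltn_add2r.
Qed.

Let range x j : j < K * (D x * D x) -> time x j < D x /\ pos x j < D x.
Proof.
move=> jK; rewrite /time /pos ltn_mod; split=> //.
by rewrite !ltn_divLR // ?D0 // mulnC.
Qed.

Let code_range x j : kind j + K * (time x j + D x * pos x j) = j.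
Proof.
rewrite /kind /time /pos [D x * _]mulnC [_ %% D x + _]addnC -divn_eq.
by rewrite addnC mulnC -divn_eq.
Qed.

Lemma literal_dfn s : dfnb C (fun x r => literal x (r 0) (r 1) s).
Proof.
have dg xi f g : dfn C f -> dfn C g -> dfnb C (fun x r => guard xi x (f x r) (g x r)).
  exact: (dfn_app2 (F := fun x t p => nat_of_bool (guard xi x t p))).
have dp xi z := dfn_app4 (F := fun x t p t' p' => nat_of_bool (prem xi x t p z t' p'))
  (dprem xi z).
have dc xi z := dfn_app4 (F := fun x t p t' p' => nat_of_bool (conc xi x t p z t' p'))
  (dconc xi z).
rewrite /literal /kind /time /pos.
by case: s; dfn_auto; (apply: dg || apply: dc || apply: dp); dfn_auto.
Qed.

Lemma num_clauses_dfn : dfn C (fun x _ => num_clauses x).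
Proof. by rewrite /num_clauses; dfn_auto. Qed.

Lemma sat_literal x : sat (num_clauses x) (literal x) <->
  exists F : Z -> nat -> nat -> bool, forall xi t p, t < D x -> p < D x ->
    guard xi x t p -> exists z t' p', [/\ t' < D x, p' < D x &
      if F z t' p' then conc xi x t p z t' p' else prem xi x t p z t' p'].
Proof.
split.
  case=> a Ha; exists (fun z t p => a (code x (enum_rank z) t p)) => xi t p tD pD g.
  have [ek et ep /andP[_ lt]] := codeP (rank_lt xi (leq_maxr _ _)) tD pD.
  have [i /and3P[i0 ilt /forallP/(_ xi)]] := Ha _ lt.
  rewrite ek et ep eqxx g /= => /existsP[z /andP[/eqP ei H]].
  have [ti pi] := range ilt; exists z, (time x i), (pos x i).
  by rewrite /code -ei code_range; split=> //; case: (a i) H.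
case=> F HF.
exists (fun i => [exists z, (kind i == (enum_rank z).+1) && F z (time x i) (pos x i)]).
move=> j jlt.
have lt1 : 1 < num_clauses x by rewrite /num_clauses; have := D0 x; rewrite /K; nia.
case: (pickP (fun xi => (kind j == (enum_rank xi).+1) &&
    guard xi x (time x j) (pos x j))) => [xi /andP[ej g]|none]; last first.
  exists 1; rewrite lt1 /=; apply/forallP => xi; apply/implyP => ej.
  by apply/implyP => g; have := none xi; rewrite ej g.
have [tj pj] := range jlt.
have [z [t [p [tD pD Hz]]]] := HF xi _ _ tj pj g.
have [ek et ep /andP[i0 ilt]] := codeP (rank_lt z (leq_maxl _ _)) tD pD.
exists (code x (enum_rank z) t p); rewrite i0 ilt /=.
apply/forallP => xi'; apply/implyP => ej'; apply/implyP => _.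
have -> : xi' = xi.
  by move: ej'; rewrite (eqP ej) eqSS => /eqP/val_inj/enum_rank_inj.
apply/existsP; exists z; rewrite ek et ep eqxx /=.
have -> : [exists z', ((enum_rank z).+1 == (enum_rank z').+1) && F z' t p] = F z t p.
  apply/existsP/idP => [[z']|Fz]; last by exists z; rewrite eqxx.
  by rewrite eqSS => /andP[/eqP/val_inj/enum_rank_inj ->].
by case: (F z t p) Hz.
Qed.

Lemma clauses_reduce (L : language A) sp :
  (forall x, L x <->
  exists F : Z -> nat -> nat -> bool, forall xi t p, t < D x -> p < D x ->
    guard xi x t p -> exists z t' p', [/\ t' < D x, p' < D x &
      if F z t' p' then conc xi x t p z t' p' else prem xi x t p z t' p']) ->
  poly_reduces L (cover_language sp).
Proof.
move=> HL; apply: (sat_reduces num_clauses_dfn literal_dfn).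
  by move=> x; rewrite /num_clauses !muln_gt0 D0.
by move=> x; rewrite HL sat_literal.
Qed.

End Clauses.

(** * The computation tableau *)

Section Cells.
Variable G : Type.

(* The head is at position [T]. *)
Definition cell (T : nat) (t : tape G) (p : nat) : option G :=
  if p < T then nth None (tleft t) (T - p).-1
  else nth None (thead t :: tright t) (p - T).

(** The head being kept in place, a move shifts the tape the opposite way: what arrives at position
    [p] comes from [source m p]. *)
Definition source (m : move) (p : nat) : nat :=
  match m with MoveLeft => p.-1 | Stay => p | MoveRight => p.+1 end.

Lemma cell_head T t : cell T t T = thead t.
Proof. by rewrite /cell ltnn subnn. Qed.

Lemma cell_move T m a t p : 0 < p ->
  cell T (move_head m (write a t)) p =
  if source m p == T then a else cell T t (source m p).
Proof.
case: t => l h r p0; rewrite /cell; case: m => /=.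
- case: (ltngtP p T) p0 => [lt|gt|->] p0.
  + have -> : p.-1 < T by lia.
    rewrite ltn_eqF; last by lia.
    by rewrite nth_behead; congr nth; lia.
  + case: (p.-1 =P T) => [e|ne].
      by have -> : p - T = 1 by lia.
    have -> : (p.-1 < T) = false by lia.
    have -> : p - T = (p - T).-2.+2 by lia.
    by have -> : p.-1 - T = (p - T).-2.+1 by lia.
  + have -> : T.-1 < T by lia.
    rewrite ltn_eqF; last by lia.
    have -> : (T - T.-1).-1 = 0 by lia.
    by rewrite subnn /= nth0.
- case: (ltngtP p T) => [lt|gt|->] //.
    by have -> : p - T = (p - T).-1.+1 by lia.
  by rewrite subnn.
- case: (ltngtP p.+1 T) => [lt|gt|e].
  + have -> : (T - p).-1 = (T - p.+1).-1.+1 by lia.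
    by [].
  + have -> : p.+1 - T = (p - T).+1 by lia.
    by case: (p - T) => [|k] /=; rewrite ?nth0 ?nth_behead.
  + by have -> : (T - p).-1 = 0 by lia.
Qed.
End Cells.

Lemma onth_lt (S : Type) (s : seq S) n : n < size s -> exists a, onth s n = Some a.
Proof. by elim: s n => [|a s IH] [|n] //=; [exists a | apply: IH]. Qed.

(** * The clauses of an accepting run *)

Section Tableau.
Variables (A : finType) (V : pred (seq (A + bool))) (c d : nat).
Variables (G : finType) (iA : A + bool -> G) (iB : bool -> G) (M : machine G).
Variables (c' d' : nat).
Hypothesis iB_inj : injective iB.
Hypothesis MV : forall w : seq (A + bool),
  computes_in M (map iA w) (poly_bound c' d' (size w)) (map iB [:: V w]).

Notation k := (ntapes' M).+1.
Notation scan := {ffun 'I_k -> option G}.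
Notation Z := (state M + 'I_k * option G)%type.
Notation Xi := (option (option (option 'I_k)) +
                state M * scan * option ('I_k * option G))%type.

Let m (x : seq A) := poly_bound c d (size x).
Let T (x : seq A) := poly_bound c' d' (size x + m x).
(** Each step loses a cell at either end, so at time [t] the contents are under control only for
    [t <= p] and [p + t < D x]. This width keeps the scanned cell [T x] in range up to time [T x],
    which bounds the running time for all admissible certificates. *)
Let D x := 2 * T x + 2.

(** A halted machine idles, so the answer can be read at the fixed time [T x]. *)
Let next (q : state M) (s : scan) : state M * {ffun 'I_k -> option G * move} :=
  if halting q then (q, [ffun i => (s i, Stay)]) else delta q s.

(* The clause kinds are, in this order: the machine does not reject, it starts
   in its start state, blanks after the word are followed by blanks, initial
   contents of the tapes, next state, next contents of a cell. *)
Definition tguard (xi : Xi) (x : seq A) (t p : nat) : bool :=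
  match xi with
  | inl (Some (Some None)) => (T x + size x <= p) && (p.+1 < D x)
  | inl _ => true
  | inr (_, None) => t < T x
  | inr (_, Some _) => [&& t < T x, 0 < p & p.+1 < D x]
  end.

Definition tprem (xi : Xi) (x : seq A) (t p : nat) (z : Z) (t' p' : nat) : bool :=
  match xi with
  | inl None =>
      [&& z == inr (ord_max, Some (iB false)), t' == T x & p' == T x]
  | inl (Some (Some None)) => [&& z == inr (ord0, None), t' == 0 & p' == p]
  | inl _ => false
  | inr (q, s, o) =>
      [|| [&& z == inl q, t' == t & p' == 0],
          [&& [exists i, z == inr (i, s i)], t' == t & p' == T x] |
          if o is Some (i, a) then
            [&& z == inr (i, a), t' == t & p' == source (((next q s).2 i).2) p]
          else false]
  end.

Definition tconc (xi : Xi) (x : seq A) (t p : nat) (z : Z) (t' p' : nat) : bool :=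
  match xi with
  | inl None => false
  | inl (Some None) => [&& z == inl (start M), t' == 0 & p' == 0]
  | inl (Some (Some None)) => [&& z == inr (ord0, None), t' == 0 & p' == p.+1]
  | inl (Some (Some (Some i))) =>
      [&& t' == 0, p' == p &
       if i == ord0 then
         [|| (z == inr (i, None)) && ((p < T x) || (T x + size x <= p)),
             [exists b : A, [&& z == inr (i, Some (iA (inl b))), T x <= p &
                oapp (pred1 b) false (onth x (p - T x))]] |
             [exists b : bool, [&& z == inr (i, Some (iA (inr b))),
                T x + size x <= p & p < T x + size x + m x]]]
       else z == inr (i, None)]
  | inr (q, s, None) => [&& z == inl (next q s).1, t' == t.+1 & p' == 0]
  | inr (q, s, Some (i, a)) =>
      let: (w, mv) := (next q s).2 i in
      [&& t' == t.+1, p' == p &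
          if source mv p == T x then z == inr (i, w) else z == inr (i, a)]
  end.

Let run (w : seq (A + bool)) t := iter t (@step G M) (initial M (map iA w)).

Let tp w t i := ctapes (run w t) i.

Let scan_at w t : scan := [ffun i => thead (tp w t i)].

Let step_next (cf : config M) :
  let a := next (cstate cf) [ffun i => thead (ctapes cf i)] in
  cstate (step cf) = a.1 /\
  forall i, ctapes (step cf) i = move_head (a.2 i).2 (write (a.2 i).1 (ctapes cf i)).
Proof.
case: cf => q ts; rewrite /step /next [cstate _]/= [ctapes _]/=.
case: ifP => _; first by split=> // i; rewrite !ffunE; case: (ts i).
by case: (@delta G M q _) => q' a; split=> // i; rewrite ffunE.
Qed.

Lemma run_next w t : let a := next (cstate (run w t)) (scan_at w t) in
  cstate (run w t.+1) = a.1 /\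
  forall i, tp w t.+1 i = move_head (a.2 i).2 (write (a.2 i).1 (tp w t i)).
Proof. exact: step_next. Qed.

Lemma run_accepts w t : poly_bound c' d' (size w) <= t ->
  thead (tp w t ord_max) = Some (iB (V w)).
Proof.
move=> le; have [h o] := MV w; rewrite /tp /run -(subnK le) iterD.
rewrite iter_fix; last by rewrite /step h.
move: o; rewrite /output /word_of_tape; case: (ctapes _ _) => l [a|] r //=.
by case=> ->.
Qed.

Lemma poly_bound_mono a b n n' : n <= n' -> poly_bound a b n <= poly_bound a b n'.
Proof.
move=> le; rewrite /poly_bound leq_add2r leq_mul2l; apply/orP; right.
by case: b => // b; rewrite leq_exp2r.
Qed.

Lemma cell_initial w T0 p :
  cell T0 (tape_of_word (map iA w)) p = if p < T0 then None else omap iA (onth w (p - T0)).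
Proof.
rewrite /cell; case: ifP => _; first exact: nth_nil.
rewrite -onth_map onthE; case: w => [|a w] //=.
by case: (p - T0) => [|[|n]].
Qed.

(** [F] is the set of facts of the actual run. A transition clause about another state, scan or
    letter has a false premise; for the actual ones, the next configuration makes the conclusion
    true. *)
Lemma tableau_complete x y : size y <= m x -> V (pair_word x y) ->
  exists F : Z -> nat -> nat -> bool, forall xi t p, t < D x -> p < D x ->
    tguard xi x t p -> exists z t' p', [/\ t' < D x, p' < D x &
      if F z t' p' then tconc xi x t p z t' p' else tprem xi x t p z t' p'].
Proof.
move=> ym Vy; set w := pair_word x y in Vy.
have szw : size w = size x + size y by rewrite size_cat !size_map.
pose F (z : Z) t p := match z with
  | inl q => q == cstate (run w t)
  | inr (i, a) => a == cell (T x) (tp w t i) p end.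
exists F => xi t p tD pD.
have D0 : 0 < D x by rewrite /D; lia.
have TD : T x < D x by rewrite /D; lia.
case: xi => [[[[i|]|]|]|[[q s] o]] /=.
- have ei : tp w 0 i = tape_of_word (if i == ord0 then map iA w else [::]).
    by rewrite /tp /run /= ffunE.
  move=> _; exists (inr (i, cell (T x) (tp w 0 i) p)), 0, p; split=> //.
  rewrite /F eqxx !eqxx /= ei; case: (i =P ord0) => // _; last first.
    by have := cell_initial [::] (T x) p; rewrite onth_default // if_same => ->.
  rewrite cell_initial; case: ltnP => [lt|ge]; first by rewrite eqxx.
  rewrite /w /pair_word onth_cat size_map onth_map.
  case: ltnP => [lt|ge2].
    have [b e] := onth_lt lt; apply/or3P/Or32/existsP; exists b.
    by rewrite e /= !eqxx.
  have le : T x + size x <= p by lia.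
  rewrite onth_map; case: (ltnP (p - T x - size x) (size y)) => [lt|ge3].
    have [b e] := onth_lt lt; apply/or3P/Or33/existsP; exists b.
    by rewrite e /= eqxx le /=; lia.
  by rewrite onth_default //= eqxx le.
- move=> /andP[le pD']; have e0 : tp w 0 ord0 = tape_of_word (map iA w).
    by rewrite /tp /run /= ffunE.
  case: (boolP (F (inr (ord0, None)) 0 p)) => Fp; last first.
    by exists (inr (ord0, None)), 0, p; rewrite (negPf Fp) !eqxx.
  exists (inr (ord0, None)), 0, p.+1; split=> //.
  suff -> : F (inr (ord0, None)) 0 p.+1 by rewrite !eqxx.
  move: Fp; rewrite /F e0 !cell_initial ltnNge (leq_trans (leq_addr _ _) le) /=.
  have -> : (p.+1 < T x) = false by lia.
  case: (ltnP (p - T x) (size w)) => [/onth_lt[b ->] //|ge] _.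
  rewrite onth_default; first exact: eqxx.
  exact: leq_trans ge (leq_sub2r _ (leqnSn p)).
- by move=> _; exists (inl (start M)), 0, 0; rewrite /= !eqxx.
- move=> _; exists (inr (ord_max, Some (iB false))), (T x), (T x); split=> //.
  rewrite !eqxx /= cell_head run_accepts ?Vy; last first.
    by apply: poly_bound_mono; rewrite szw leq_add2l.
  by case: eqP => // -[] /iB_inj.
have qs : cstate (run w t) = q -> scan_at w t = s -> let a := next q s in
    cstate (run w t.+1) = a.1 /\
    forall i, tp w t.+1 i = move_head (a.2 i).2 (write (a.2 i).1 (tp w t i)).
  by move=> <- <-; apply: run_next.
case: (q =P cstate (run w t)) => [eq|/eqP neq]; last first.
  move=> _; exists (inl q), t, 0; split=> //.
  by rewrite /= (negPf neq); case: o => [[i a]|]; rewrite !eqxx.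
case: (s =P scan_at w t) => [es|ns]; last first.
  move=> _; have [i ne] : exists i, s i != scan_at w t i.
    apply/existsP; rewrite -[[exists _, _]]negbK negb_exists; apply/negP => /forallP H.
    by case: ns; apply/ffunP => i; apply/eqP/negPn/H.
  exists (inr (i, s i)), t, (T x); split=> //=.
  rewrite cell_head; move: ne; rewrite ffunE => /negPf ->.
  have -> : [exists i0, inr (i, s i) == inr (i0, s i0) :> Z] by apply/existsP; exists i.
  by rewrite !eqxx.
have [e1 e2] := qs (esym eq) (esym es).
case: o => [[i a]|] /= g; last first.
  exists (inl (next q s).1), t.+1, 0; split=> //; first by rewrite /D; lia.
  by rewrite /= -e1 !eqxx.
case/and3P: g => tT p0 pD'.
have srcD : source ((next q s).2 i).2 p < D x.
  by case: ((next q s).2 i).2 => //=; lia.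
case: (a =P cell (T x) (tp w t i) (source ((next q s).2 i).2 p)) => [ea|/eqP na].
  exists (inr (i, cell (T x) (tp w t.+1 i) p)), t.+1, p; split=> //.
    by rewrite /D; lia.
  rewrite /F eqxx e2 cell_move // -ea; case: ((next q s).2 i) => v mv /=.
  by case: ifP => e; rewrite ?e !eqxx.
exists (inr (i, a)), t, (source ((next q s).2 i).2 p); split=> //.
by rewrite /= (negPf na) !eqxx /= !orbT.
Qed.

(** [F] may assign several contents to a cell. A certificate is read off [F], and by induction on
    time [F] contains the facts of the run on it, within the controlled window. A rejecting run
    would thus put the rejecting letter into [F], against the first kind of clause. *)
Lemma tableau_sound x (F : Z -> nat -> nat -> bool) :
  (forall xi t p, t < D x -> p < D x ->
    tguard xi x t p -> exists z t' p', [/\ t' < D x, p' < D x &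
      if F z t' p' then tconc xi x t p z t' p' else tprem xi x t p z t' p']) ->
  exists y, size y <= m x /\ V (pair_word x y).
Proof.
move=> HF.
have D0 : 0 < D x by rewrite /D; lia.
have TD : T x < D x by rewrite /D; lia.
(* The certificate ends at the first cell after [x] that [F] allows to be blank; the clauses on
   successive blanks make the later cells blank too. A cell marked with both bits is read as
   [true]. *)
pose bit j b := F (inr (ord0, Some (iA (inr b)))) 0 (T x + size x + j).
pose blank j := F (inr (ord0, None)) 0 (T x + size x + j).
pose l := find blank (iota 0 (m x)).
have lm : l <= m x by apply: leq_trans (find_size _ _) _; rewrite size_iota.
pose y := mkseq (fun j => bit j true) l.
have szy : size y = l by rewrite size_mkseq.
exists y; split; first by rewrite szy.
set w := pair_word x y.
have szw : size w = size x + l by rewrite size_cat !size_map size_iota.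
have prem_conc xi t p : t < D x -> p < D x -> tguard xi x t p ->
    (forall z t' p', tprem xi x t p z t' p' -> F z t' p') ->
    exists z t' p', tconc xi x t p z t' p' /\ F z t' p'.
  move=> tD pD g H; have [z [t' [p' [_ _ Hz]]]] := HF xi t p tD pD g.
  exists z, t', p'; move: Hz; case: ifP => // Fz /H; by rewrite Fz.
have iconc i p : p < D x -> exists z, tconc (inl (Some (Some (Some i)))) x 0 p z 0 p
    /\ F z 0 p.
  move=> pD; have [//|z [t' [p' [H Fz]]]] :=
    prem_conc (inl (Some (Some (Some i)))) 0 p D0 pD isT.
  by move: (H) => /and3P[/eqP et /eqP ep _]; exists z; rewrite -{1}et -{2 3}ep -et.
have blanks p : T x + size x + l <= p -> p < D x -> F (inr (ord0, None)) 0 p.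
  move=> le; rewrite -(subnKC le); elim: (p - _) => [|q IH] pD.
    rewrite addn0 in pD *; case: (ltngtP l (m x)) lm => // [lt|el] _.
      have h : has blank (iota 0 (m x)) by rewrite has_find size_iota.
      by have := nth_find 0 h; rewrite -/l nth_iota.
    have [z [/and3P[_ _] H Fz]] := iconc ord0 _ pD.
    case/or3P: H => [/andP[/eqP<- //]|/existsP[b]|/existsP[b]].
      move=> /and3P[_ _]; rewrite onth_default //; lia.
    by rewrite el ltnn !andbF.
  have pD' : T x + size x + l + q < D x by apply: ltn_trans pD; rewrite ltn_add2l.
  have g : tguard (inl (Some (Some None))) x 0 (T x + size x + l + q).
    by rewrite /= -addnS pD andbT -[_ + l + q]addnA leq_addr.
  have [|z [t' [p' [H Fz]]]] := prem_conc _ 0 _ D0 pD' g.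
    by move=> z t' p' /and3P[/eqP-> /eqP-> /eqP->]; apply: IH.
  by move: H Fz => /and3P[/eqP-> /eqP-> /eqP->]; rewrite addnS.
have init i p : p < D x -> F (inr (i, cell (T x) (tp w 0 i) p)) 0 p.
  move=> pD; have -> : tp w 0 i = tape_of_word (if i == ord0 then map iA w else [::]).
    by rewrite /tp /run /= ffunE.
  have [z [/and3P[_ _ H] Fz]] := iconc i p pD.
  case: (i =P ord0) H => [->|_ /eqP ez]; last first.
    by have := cell_initial [::] (T x) p; rewrite onth_default // if_same => ->; rewrite -ez.
  rewrite cell_initial; case: ltnP => [lt|ge].
    case/or3P => [/andP[/eqP<- //]|/existsP[b]|/existsP[b]].
      by rewrite andbF.
    by case/and3P => _ ge _; move: lt; lia.
  rewrite /w /pair_word onth_cat size_map onth_map.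
  case: (ltnP (p - T x) (size x)) => [lt|ge2].
    rewrite ltn_subLR // in lt.
    case/or3P => [/andP[_]|/existsP[b]|/existsP[b]].
    - by rewrite leqNgt lt.
    - by case: (onth x _) => [b'|] /and3P[/eqP ez _ //= /eqP eb]; rewrite eb -ez.
    - by case/and3P => _; rewrite leqNgt lt.
  have e : p = T x + size x + (p - T x - size x) by lia.
  rewrite onth_map; case: (ltnP (p - T x - size x) l) => [lt|ge3]; last first.
    move=> _; rewrite onth_default; last by rewrite szy.
    by apply: blanks pD; lia.
  rewrite /y /mkseq onth_map.
  have -> : onth (iota 0 l) (p - T x - size x) = Some (p - T x - size x).
    by rewrite onthE (nth_map 0) ?size_iota // nth_iota.
  case/or3P => [/andP[/eqP ez _]|/existsP[b]|/existsP[b /and3P[/eqP ez _ _]]].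
  - have := before_find 0 lt; rewrite nth_iota; last by apply: leq_trans lt lm.
    by rewrite /blank add0n -e -ez Fz.
  - move=> /and3P[_ _]; rewrite onth_default //; lia.
  - rewrite ez in Fz; rewrite /= /bit -e.
    case Fb: (F (inr (ord0, Some (iA (inr true)))) 0 p) => //.
    by case: (b) Fz => //; rewrite Fb.
have facts t : t <= T x -> F (inl (cstate (run w t))) t 0 /\
    forall i p, t <= p -> p + t < D x -> F (inr (i, cell (T x) (tp w t i) p)) t p.
  elim: t => [|t IH] tT.
    split; last by move=> i p _; rewrite addn0; apply: init.
    have [//|z [t' [p' [H Fz]]]] := prem_conc (inl (Some None)) 0 0 D0 D0 isT.
    by move: H Fz => /and3P[/eqP-> /eqP-> /eqP->].
  have [Fq Fc] := IH (ltnW tT); have tD : t < D x by rewrite /D; lia.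
  have [e1 e2] := run_next w t.
  have base o z t' p' : [|| [&& z == inl (cstate (run w t)), t' == t & p' == 0],
      [&& [exists i, z == inr (i, scan_at w t i)], t' == t & p' == T x] | o] ->
      F z t' p' \/ o.
    case/or3P => [/and3P[/eqP-> /eqP-> /eqP->]|/and3P[/existsP[i /eqP->] /eqP-> /eqP->]|];
      last by right.
      by left.
    left; rewrite ffunE -(cell_head (T x)); apply: Fc; first exact: ltnW.
    by rewrite /D; lia.
  split.
    have [|z [t' [p' [H Fz]]]] :=
      prem_conc (inr (cstate (run w t), scan_at w t, None)) t 0 tD D0 tT.
      by move=> z t' p' /base[].
    by move: H Fz => /and3P[/eqP-> /eqP-> /eqP->]; rewrite e1.
  move=> i p tp_ pD; set a := next _ _ in e1 e2.
  have p0 : 0 < p by apply: leq_ltn_trans tp_.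
  have [pD1 pD2] : p < D x /\ p.+1 < D x by lia.
  have srcD : t <= source (a.2 i).2 p /\ source (a.2 i).2 p + t < D x.
    by case: (a.2 i).2 => /=; lia.
  have g : tguard (inr (cstate (run w t), scan_at w t,
      Some (i, cell (T x) (tp w t i) (source (a.2 i).2 p)))) x t p by rewrite /= tT p0.
  have [|z [t' [p' [H Fz]]]] := prem_conc _ _ _ tD pD1 g.
    move=> z t' p' /base[//|/and3P[/eqP-> /eqP-> /eqP->]].
    by apply: Fc; case: srcD.
  rewrite e2 cell_move //; move: H Fz; rewrite /= -/a.
  case: (a.2 i) => v mv /= /and3P[/eqP-> /eqP->].
  by case: ifP => _ /eqP->.
have [_ /(_ ord_max (T x) (leqnn _))] := facts (T x) (leqnn _).
rewrite cell_head run_accepts; last first.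
  by apply: poly_bound_mono; rewrite szw leq_add2l.
case: (V w) => // /(_ _) H; have {}H : F (inr (ord_max, Some (iB false))) (T x) (T x).
  by apply: H; rewrite /D; lia.
have [|z [t [p []]]] // := prem_conc (inl None) 0 0 D0 D0 isT.
by move=> z t p /and3P[/eqP-> /eqP-> /eqP->].
Qed.

Notation C := (option bool).

Let dT : dfn C (fun x _ => T x).
Proof. by rewrite /T /m /poly_bound; dfn_auto. Qed.

Let dsource mv : dfn C (fun (_ : seq A) r => source mv (r 1)).
Proof.
case: mv => /=; dfn_auto.
by apply: dfn_ext (dfn_sub (dfn_var A C 1) (dfn_const A C 1)) => x r; rewrite subn1.
Qed.

Let dguard xi : dfnb C (fun x r => tguard xi x (r 0) (r 1)).
Proof. by case: xi => [[[[i|]|]|]|[[q s] [[i a]|]]] /=; rewrite /D; dfn_auto. Qed.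

Let dprem xi z : dfnb C (fun x r => tprem xi x (r 0) (r 1) z (r 2) (r 3)).
Proof.
case: xi => [[[[i|]|]|]|[[q s] [[i a]|]]] /=; dfn_auto.
Qed.

Let dconc xi z : dfnb C (fun x r => tconc xi x (r 0) (r 1) z (r 2) (r 3)).
Proof.
have dm : dfn C (fun x _ => m x) by rewrite /m /poly_bound; dfn_auto.
case: xi => [[[[i|]|]|]|[[q s] [[i a]|]]] /=; dfn_auto.
  by case: (i == ord0); dfn_auto.
case: ((next q s).2 i) => w mv; dfn_auto.
by apply: dfn_ifb; dfn_auto; apply: dfn_eq; dfn_auto; apply: dsource.
Qed.

Lemma tableau_reduces (L : language A) sp :
  (forall x, L x <-> exists y, size y <= m x /\ V (pair_word x y)) ->
  poly_reduces L (cover_language sp).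
Proof.
move=> HL; have D0 x : 0 < D x by rewrite /D; lia.
have dD : dfn C (fun x _ => D x) by rewrite /D; dfn_auto.
apply: (clauses_reduce D0 dD dguard dprem dconc).
move=> x; rewrite HL; split=> [[y [ym Vy]]|[F HF]].
  exact: tableau_complete ym Vy.
exact: tableau_sound HF.
Qed.

End Tableau.

Lemma cover_language_NP_hard sp : NP_hard (cover_language sp).
Proof.
move=> A L [V [c [d [[G [iA [iB [M [c' [d' [_ iB_inj MV]]]]]]] HL]]]].
exact: (tableau_reduces iB_inj MV).
Qed.

(** * Membership in NP *)

Lemma all_iotaP (P : pred nat) n :
  reflect (forall i, i < n -> P i) (all P (iota 0 n)).
Proof.
by apply: (iffP allP) => H i; [move=> lt; apply: H | move: (H i)]; rewrite mem_iota.
Qed.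

Lemma has_iotaP (P : pred nat) n :
  reflect (exists2 i, i < n & P i) (has P (iota 0 n)).
Proof.
by apply: (iffP hasP) => -[i lt Pi]; exists i => //; move: lt; rewrite mem_iota.
Qed.

Lemma eq_all_iota (P Q : pred nat) n : (forall i, i < n -> P i = Q i) ->
  all P (iota 0 n) = all Q (iota 0 n).
Proof. by move=> H; apply: eq_in_all => i; rewrite mem_iota; apply: H. Qed.

Lemma eq_has_iota (P Q : pred nat) n : (forall i, i < n -> P i = Q i) ->
  has P (iota 0 n) = has Q (iota 0 n).
Proof. by move=> H; apply: eq_in_has => i; rewrite mem_iota; apply: H. Qed.

Definition mcoverb n (e : nat -> nat -> bool) m (W : nat -> nat -> bool) : bool :=
  [&& all (fun u => has (fun i => W i u) (iota 0 m)) (iota 0 n),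
      all (fun i => all (fun u => all (fun v => all (fun w =>
        e u v ==> (e v w ==> (~~ (u == w) ==> (W i u ==> (W i w ==> W i v)))))
        (iota 0 n)) (iota 0 n)) (iota 0 n)) (iota 0 m) &
      all (fun i => has (fun u => ~~ W i u) (iota 0 n)) (iota 0 m)].

Lemma mcoverP n e m : mcover n e m <-> exists W, mcoverb n e m W.
Proof.
split=> [[W [H1 H2 H3]]|[W /and3P[/all_iotaP H1 /all_iotaP H2 /all_iotaP H3]]]; exists W.
  apply/and3P; split; apply/all_iotaP.
  - by move=> u un; apply/has_iotaP/H1.
  - move=> i im; apply/all_iotaP => u un; apply/all_iotaP => v vn.
    apply/all_iotaP => w wn; apply/implyP => euv; apply/implyP => evw.
    apply/implyP => uw; apply/implyP => Wu; apply/implyP => Ww.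
    exact: (H2 i u v w).
  - by move=> i im; apply/has_iotaP/H3.
split=> [u un|i u v w im un vn wn euv evw uw Wu Ww|i im]; try exact/has_iotaP/H1.
  have /all_iotaP/(_ _ un)/all_iotaP/(_ _ vn)/all_iotaP/(_ _ wn) := H2 i im.
  by rewrite euv evw uw Wu Ww.
exact/has_iotaP/H3.
Qed.

Definition msplitb n (e : nat -> nat -> bool) (K : nat -> bool) : bool :=
  all (fun u => all (fun v => ((K u && K v) && ~~ (u == v) ==> e u v) &&
    (~~ K u && ~~ K v ==> ~~ e u v)) (iota 0 n)) (iota 0 n).

Lemma msplitP n e : msplit n e <-> exists K, msplitb n e K.
Proof.
split=> -[K HK]; exists K.
  apply/all_iotaP => u un; apply/all_iotaP => v vn; have [H1 H2] := HK u v un vn.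
  apply/andP; split; apply/implyP; first by case/andP => /andP[]; apply: H1.
  by case/andP; apply: H2.
move=> u v un vn; have /all_iotaP/(_ _ un)/all_iotaP/(_ _ vn)/andP[H1 H2] := HK.
split=> [uK vK uv|uK vK]; first by apply: (implyP H1); rewrite uK vK.
by apply: (implyP H2); rewrite uK vK.
Qed.

Definition mgraphb n (e : nat -> nat -> bool) : bool :=
  all (fun u => ~~ e u u && all (fun v => e u v == e v u) (iota 0 n)) (iota 0 n).

Lemma mgraphP n e : reflect (mgraph n e) (mgraphb n e).
Proof.
apply: (iffP (all_iotaP _ _)) => [H|[sym irr] u un].
  split=> [u v un vn|u un]; have /andP[] := H u un => //.
  by move=> _ /all_iotaP/(_ v vn)/eqP.
by rewrite irr //; apply/all_iotaP => v vn; rewrite sym.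
Qed.

Lemma eq_mgraphb n e e' : (forall u v, u < n -> v < n -> e u v = e' u v) ->
  mgraphb n e = mgraphb n e'.
Proof.
move=> E; apply: eq_all_iota => u un; rewrite E //; congr (_ && _).
by apply: eq_all_iota => v vn; rewrite !E.
Qed.

Lemma eq_mcoverb n e e' m W W' : (forall u v, u < n -> v < n -> e u v = e' u v) ->
  (forall i u, i < m -> u < n -> W i u = W' i u) ->
  mcoverb n e m W = mcoverb n e' m W'.
Proof.
move=> E EW; congr [&& _, _ & _].
- by apply: eq_all_iota => u un; apply: eq_has_iota => i im; apply: EW.
- apply: eq_all_iota => i im; apply: eq_all_iota => u un.
  by apply: eq_all_iota => v vn; apply: eq_all_iota => w wn; rewrite !E ?EW.
- by apply: eq_all_iota => i im; apply: eq_has_iota => u un; rewrite EW.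
Qed.

Lemma eq_msplitb n e e' K K' : (forall u v, u < n -> v < n -> e u v = e' u v) ->
  (forall u, u < n -> K u = K' u) -> msplitb n e K = msplitb n e' K'.
Proof.
move=> E EK; apply: eq_all_iota => u un; apply: eq_all_iota => v vn.
by rewrite !E ?EK.
Qed.

Lemma mcover_small n e p : 2 <= p -> mcover n e p ->
  exists m, [/\ 0 < m, m <= p, m <= n & mcover n e m].
Proof.
move=> p2 cp; case: (leqP p n) => [pn|np]; first by exists p; split=> //; lia.
have [W [H1 H2 H3]] := cp.
(* A graph with at most one vertex has no cover by proper sets; from two vertices on, singletons are
   proper. *)
have n2 : 1 < n.
  have p0 : 0 < p by lia.
  case: n np H1 H3 {H2 cp} => [|[|n]] // _ H1 H3; first by have [] := H3 0 p0.
  have [i ip Wi] := H1 0 isT; have [[|u]] // := H3 i ip.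
  by rewrite Wi.
exists n; split=> //; [by lia | by lia | exists (fun i u => u == i); split].
- by move=> u un; exists u.
- by move=> i u v w _ _ _ _ _ _ uw /eqP ui /eqP wi; rewrite ui wi eqxx in uw.
- move=> i iN; case: (posnP i) => [->|i0]; first by exists 1.
  by exists 0; [lia | rewrite eq_sym -lt0n].
Qed.

(** The surplus indices repeat set 0. Hence only a comparison of [m] with the number in the input is
    required of the verifier. *)
Lemma mcover_le n e m p : 0 < m -> m <= p -> mcover n e m -> mcover n e p.
Proof.
move=> m0 mp [W [H1 H2 H3]].
have lt i : (if i < m then i else 0) < m by case: ifP.
exists (fun i => W (if i < m then i else 0)); split=> [u un|i|i ip].
- by have [i im Wi] := H1 u un; exists i; rewrite ?im //; apply: leq_trans im mp.
- by move=> u v w _; apply: H2.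
- exact: H3.
Qed.

(** Beyond the end of the word every test fails, so such tests can also express where a word
    ends. *)
Definition at_ (S : eqType) (w : seq S) (s : S) k : bool :=
  oapp (pred1 s) false (onth w k).

Lemma at_inl (A B : eqType) (x : seq A) (y : seq B) s k :
  at_ (map inl x ++ map inr y) (inl s) k = at_ x s k.
Proof.
rewrite /at_ onth_cat size_map !onth_map; case: ltnP => [_|ge].
  by case: (onth x k).
by rewrite (onth_default ge); case: (onth y _).
Qed.

Lemma at_inr (A B : eqType) (x : seq A) (y : seq B) s k :
  at_ (map inl x ++ map inr y) (inr s) (size x + k) = at_ y s k.
Proof.
rewrite /at_ onth_cat size_map ltnNge leq_addr addKn !onth_map.
by case: (onth y k).
Qed.

Lemma at_lt (S : eqType) (w : seq S) s k : at_ w s k -> k < size w.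
Proof. by rewrite /at_; case: ltnP => // /onth_default ->. Qed.

Lemma at_nth (S : eqType) (x0 : S) w s k : at_ w s k -> nth x0 w k = s.
Proof.
by rewrite /at_; case e: (onth w k) => [a|] //= /eqP <-; apply: onth_nth e.
Qed.

Lemma at_mkseq (S : eqType) (f : nat -> S) n s k : k < n ->
  at_ (mkseq f n) s k = (f k == s).
Proof.
by move=> kn; rewrite /at_ onth_map onthE (nth_map 0) ?size_iota // nth_iota.
Qed.

(** * The verifier *)

Section Verifier.
Notation A := (option bool + bool)%type.
Implicit Type w : seq A.

(** The negated disjunction says that no input letter stands at position [l.+1 + n * n.+1], where
    the certificate has to begin; the last condition excludes leading zeros. *)
Definition wordb l n w : bool :=
  let e u v := at_ w (inl (Some true)) (l.+1 + (u * n.+1 + v)) in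
  [&& all (fun k => at_ w (inl (Some true)) k || at_ w (inl (Some false)) k) (iota 0 l),
      at_ w (inl None) l,
      all (fun u => at_ w (inl None) (l.+1 + (u * n.+1 + n)) &&
        all (fun v => e u v || at_ w (inl (Some false)) (l.+1 + (u * n.+1 + v)))
          (iota 0 n)) (iota 0 n),
      ~~ [|| at_ w (inl None) (l.+1 + n * n.+1),
             at_ w (inl (Some true)) (l.+1 + n * n.+1) |
             at_ w (inl (Some false)) (l.+1 + n * n.+1)] &
      (l == 0) || at_ w (inl (Some true)) (l - 1)].

(** This is tried only on the candidates [p < m.+2], since the number written in the input may be
    exponentially large. *)
Definition is_binary l w p : bool :=
  (up_log 2 p.+1 == l) &&
  all (fun k => at_ w (inl (Some true)) k == odd (p %/ pow2_upto p k)) (iota 0 l).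

(* The certificate lists the clique, then the [m] sets of the cover. *)
Definition check (sp : bool) l n m w : bool :=
  let s := l.+1 + n * n.+1 in
  let e u v := at_ w (inl (Some true)) (l.+1 + (u * n.+1 + v)) in
  [&& wordb l n w, mgraphb n e,
      all (fun p => (p < m) || (p < 2) ==> ~~ is_binary l w p) (iota 0 m.+2),
      0 < m,
      mcoverb n e m (fun i u => at_ w (inr true) (s + (n + (i * n + u)))) &
      sp ==> msplitb n e (fun u => at_ w (inr true) (s + u))].

(** The numbers of digits, vertices and sets are found by bounded search, which replaces parsing. *)
Definition verifier sp w : bool :=
  has (fun l => has (fun n => has (fun m => check sp l n m w)
    (iota 0 (size w).+1)) (iota 0 (size w).+1)) (iota 0 (size w).+1).

Lemma dfn_at s (f : seq A -> env -> nat) : dfn bool f ->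
  dfnb bool (fun w r => at_ w s (f w r)).
Proof. exact: dfn_onth. Qed.

Lemma verifier_polytime sp : polytime_pred (verifier sp).
Proof.
have dV : dfnb bool (fun w _ => verifier sp w).
  rewrite /verifier /check /wordb /mgraphb /mcoverb /msplitb /is_binary.
  repeat (dfn_auto; try (apply: dfn_at || apply: dfn_bit || apply: dfn_up_log2)).
have := @polytime_mkseq A bool (fun s => s == 1) 1 (fun=> 1)
  (fun w _ => verifier sp w) (dfn_const _ _ 1) dV.
case=> [w i _|G [iA [iB [M [c [d [h1 h2 h3]]]]]]]; first by case: (verifier sp w).
exists G, iA, iB, M, c, d; split=> // w.
by have := h3 w; rewrite /mkseq /= eqb1.
Qed.

Section Word.
Variables (x : seq (option bool)) (y : seq bool).
Notation w := (pair_word x y).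

Lemma nth_binary p k : k < up_log 2 p.+1 -> nth true (binary p) k = odd (p %/ 2 ^ k).
Proof. by move=> lt; rewrite nth_mkseq. Qed.

Lemma size_binary p : size (binary p) = up_log 2 p.+1.
Proof. exact: size_mkseq. Qed.

Lemma cell_word_end n e u : u < n ->
  cell_word n e (u * n.+1 + n) = None /\ u * n.+1 + n < n * n.+1.
Proof.
move=> un; rewrite /cell_word modnMDl modn_small // eqxx; split=> //.
by have := leq_mul un (leqnn n.+1); rewrite mulSn; lia.
Qed.

Lemma wordb_word p n e : x = word p n e ->
  let l := up_log 2 p.+1 in
  [/\ wordb l n w, size x = l.+1 + n * n.+1,
      forall u v, u < n -> v < n ->
        at_ w (inl (Some true)) (l.+1 + (u * n.+1 + v)) = e u v &
      forall p', is_binary l w p' = (p' == p)].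
Proof.
move=> ex l; pose s := l.+1 + n * n.+1.
pose f k := if k < l then Some (odd (p %/ 2 ^ k)) else
  if k == l then None else cell_word n e (k - l.+1).
have ef : word p n e = mkseq f s := word_mkseq p n e.
have at_w b k : at_ w (inl b) k = (k < s) && (f k == b).
  rewrite /pair_word at_inl ex ef; case: ltnP => [lt|ge]; first exact: at_mkseq.
  by rewrite /at_ onth_default // size_mkseq.
have fl k : k < l -> at_ w (inl (Some true)) k = odd (p %/ 2 ^ k) /\
    at_ w (inl (Some false)) k = ~~ odd (p %/ 2 ^ k).
  by move=> kl; rewrite !at_w /f kl (leq_trans kl) /s ?addSn ?leqW ?leq_addr //; case: (odd _).
have fc b k : k < n * n.+1 -> at_ w (inl b) (l.+1 + k) = (cell_word n e k == b).
  move=> lt; rewrite at_w /s ltn_add2l lt /f addKn.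
  by rewrite ltnNge (leq_trans (leqnSn l)) ?leq_addr // gtn_eqF // ltn_addr.
have we u v : u < n -> v < n -> at_ w (inl (Some true)) (l.+1 + (u * n.+1 + v)) = e u v.
  by move=> un vn; have [ec lt] := cell_wordE e un vn; rewrite fc // ec; case: (e u v).
split=> //; last 1 first.
- move=> p'; apply/andP/eqP => [[/eqP el /all_iotaP H]|->]; last first.
    split=> //; apply/all_iotaP => k kl.
    by rewrite bitE // (fl k kl).1.
  apply: binary_inj; rewrite /binary el; apply/eq_in_map => k.
  rewrite mem_iota add0n => kl; have kl' : k < l by [].
  by have /eqP := H k kl; rewrite bitE ?el // (fl k kl').1.
- apply/and5P; split.
  + by apply/all_iotaP => k /fl[-> ->]; case: (odd _).
  + by rewrite at_w /f ltnn eqxx /s addSn ltnS leq_addr.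
  + apply/all_iotaP => u un; apply/andP; split.
      by have [ec lt] := cell_word_end e un; rewrite fc // ec.
    apply/all_iotaP => v vn; have [ec lt] := cell_wordE e un vn.
    by rewrite !fc // ec; case: (e u v).
  + by rewrite !at_w ltnn.
  + case: (posnP l) => [->//|l0]; have lt : l - 1 < l by lia.
    rewrite (fl _ lt).1 -nth_binary // subn1 /l -size_binary nth_last.
    by rewrite last_binary orbT.
- by rewrite ex ef size_mkseq.
Qed.

Lemma word_wordb l n : wordb l n w ->
  exists p, [/\ x = word p n (fun u v => at_ w (inl (Some true)) (l.+1 + (u * n.+1 + v))),
    l = up_log 2 p.+1 & size x = l.+1 + n * n.+1].
Proof.
case/and5P => /all_iotaP c1 c2 /all_iotaP c3 c4 c5.
pose e u v := at_ w (inl (Some true)) (l.+1 + (u * n.+1 + v)).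
have [p ep] : exists p, binary p = mkseq (fun k => at_ w (inl (Some true)) k) l.
  apply: binary_ex; case: l c5 {c1 c2 c3 c4 e} => [|l] // c5.
  by rewrite -nth_last size_mkseq nth_mkseq //; move: c5; rewrite subn1.
have el : l = up_log 2 p.+1 by rewrite -size_binary ep size_mkseq.
have at_x b k : at_ w (inl b) k = at_ x b k by apply: at_inl.
set s := l.+1 + n * n.+1 in c4 *.
have sx : size x = s.
  apply/eqP; rewrite eqn_leq; apply/andP; split.
    rewrite leqNgt; apply/negP => /onth_lt[b eb].
    by move: c4; rewrite !at_x /at_ eb; case: b {eb} => [[]|].
  rewrite /s; case: n c3 {c4 e s} => [|n] c3.
    by rewrite mul0n addn0; move: c2; rewrite at_x => /at_lt.
  have /andP[] := c3 n (ltnSn n); rewrite at_x => /at_lt lt _.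
  by apply: leq_trans lt; rewrite mulSn; lia.
exists p; split=> //; rewrite -/e word_mkseq -el -/s; apply: (@eq_from_nth _ None).
  by rewrite size_mkseq.
move=> k; rewrite sx => ks; rewrite nth_mkseq //.
case: (ltngtP k l) => [kl|lk|->].
- have -> : odd (p %/ 2 ^ k) = at_ w (inl (Some true)) k.
    by rewrite -nth_binary -?el // ep nth_mkseq.
  have := c1 k kl; case: (boolP (at_ w (inl (Some true)) k)) => [h _|_ /= h].
    by rewrite at_x in h; rewrite (at_nth None h).
  by rewrite at_x in h; rewrite (at_nth None h).
- pose j := k - l.+1; have jlt : j < n * n.+1 by rewrite /j; move: ks; rewrite /s; lia.
  have un : j %/ n.+1 < n by rewrite ltn_divLR.
  have ek : k = l.+1 + (j %/ n.+1 * n.+1 + j %% n.+1) by rewrite -divn_eq /j subnKC.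
  have /andP[h0 /all_iotaP h1] := c3 _ un.
  rewrite -/j /cell_word; case: eqP => [en|ne].
    by rewrite {1}ek en; apply: at_nth; rewrite -at_x.
  have vn : j %% n.+1 < n by have := ltn_pmod j (ltn0Sn n); lia.
  have := h1 _ vn; rewrite /e -!ek.
  case: (boolP (at_ w (inl (Some true)) _)) => [h _|_ /= h].
    by rewrite at_x in h; rewrite (at_nth None h).
  by rewrite at_x in h; rewrite (at_nth None h).
- by apply: at_nth; rewrite -at_x.
Qed.
End Word.

Lemma verifierP sp x : cover_language sp x <->
  exists y : seq bool, size y <= poly_bound 1 1 (size x) /\ verifier sp (pair_word x y).
Proof.
rewrite cover_languageE; split.
  case=> p [n [e [ge ex [p2 cp sk]]]].
  have [m [m0 mp mn /mcoverP[W HW]]] := mcover_small p2 cp.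
  have [K HK] : exists K, sp -> msplitb n e K.
    by case: (sp) sk => [/(_ isT)/msplitP[K HK]|_]; [exists K | exists (fun=> false)].
  pose y := mkseq (fun k => if k < n then K k else W ((k - n) %/ n) ((k - n) %% n))
    (n + m * n).
  have [wb sx we wbin] := wordb_word y ex.
  set l := up_log 2 p.+1 in wb sx we wbin.
  have mnn := leq_mul mn (leqnn n).
  exists y; split; first by rewrite size_mkseq sx /poly_bound mul1n expn1; lia.
  have szw : size (pair_word x y) = size x + (n + m * n).
    by rewrite size_cat !size_map size_iota.
  apply/has_iotaP; exists l; first by rewrite szw sx; lia.
  apply/has_iotaP; exists n; first by rewrite szw sx; lia.
  apply/has_iotaP; exists m; first by rewrite szw sx; nia.
  rewrite /check wb -sx (eq_mgraphb we) m0 !andTb; apply/and4P; split.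
  - exact/mgraphP.
  - apply/all_iotaP => q _; apply/implyP => small; rewrite wbin.
    by apply/eqP => eq_; move: small; rewrite eq_; lia.
  - rewrite -(@eq_mcoverb n e _ m W) // => [u v un vn|i u im un]; first by rewrite we.
    have lt : i * n + u < m * n by have := leq_mul im (leqnn n); rewrite mulSn; lia.
    rewrite at_inr at_mkseq ?ltn_add2l // ltnNge leq_addr addKn.
    by rewrite divnMDl ?modnMDl ?divn_small ?modn_small ?addn0 ?eqb_id //; lia.
  - apply/implyP => /HK H.
    rewrite -(@eq_msplitb n e _ K) // => [u v un vn|u un]; first by rewrite we.
    by rewrite at_inr at_mkseq ?ltn_addr // un eqb_id.
case=> y [_ /has_iotaP[l _ /has_iotaP[n _ /has_iotaP[m _]]]].
case/and5P => wb /mgraphP ge /all_iotaP small m0 /andP[cp sk].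
have [p [ex el sx]] := word_wordb wb.
have [_ _ _ wbin] := wordb_word y ex; rewrite -el in wbin.
exists p, n; eexists; split; [exact: ge | exact: ex |].
have p_ge q : (q < m) || (q < 2) -> p != q.
  move=> qs; apply/eqP => epq; have qlt : q < m.+2 by lia.
  by have := small q qlt; rewrite qs wbin epq eqxx.
have mp : m <= p by rewrite leqNgt; apply/negP => lt; have := p_ge p; rewrite lt eqxx => /(_ isT).
have p2 : 2 <= p.
  by rewrite leqNgt; apply/negP => lt; have := p_ge p; rewrite lt eqxx orbT => /(_ isT).
split=> // [|spt].
  by apply: (mcover_le m0 mp); apply/mcoverP; eexists; exact: cp.
by apply/msplitP; eexists; move: sk; rewrite spt; apply.
Qed.

Lemma cover_language_in_NP sp : in_NP (cover_language sp).
Proof.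
exists (verifier sp), 1, 1; split; [exact: verifier_polytime | exact: verifierP].
Qed.
End Verifier.

Theorem corollary12 :
  NP_complete P3_convex_cover_problem /\
  NP_complete P3_convex_cover_problem_split.
Proof.
have H sp : NP_complete (cover_language sp).
  by split; [exact: cover_language_in_NP | exact: cover_language_NP_hard].
by split; [exact: (H false) | exact: (H true)].
Qed.
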